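(* Let $f:\mathbb{T}\to\mathbb{C}$ be continuous with Fourier series $$f\sim\sum_{k=0}^\infty A_k(x),\qquad A_k(x)=d_k\cos(kx+\phi_k),$$ where $d_k\in\mathbb{C}$, $\phi_k\in\mathbb{R}$ and $A_0=d_0$. Suppose that $d_k=O(k^{-1/2})$ as $k\to\infty$. Then there is a permutation (bijection) $\sigma:\mathbb{N}\to\mathbb{N}$ such that $$\left\|f-d_0-\sum_{k=1}^n A_{\sigma(k)}\right\|\to0\quad(n\to\infty).$$
   Context: $\mathbb{T}=\mathbb{R}/2\pi\mathbb{Z}$ and $\mathbb{N}=\{1,2,3,\dots\}$. For a continuous function $g:\mathbb{T}\to\mathbb{C}$, $\|g\|=\max_{x\in\mathbb{T}}|g(x)|$ is the uniform norm. If $c_k=\frac1{2\pi}\int_0^{2\pi}f(x)e^{-ikx}\,dx$ ($k\in\mathbb{Z}$) are the Fourier coefficients of $f$, the notation $f\sim\sum_{k=0}^\infty A_k(x)$ means that $A_0=c_0$ and $A_k(x)=c_ke^{ikx}+c_{-k}e^{-ikx}$ for $k\ge1$. *)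

(* Defs.v *)
(* Stdlib reals with Coquelicot. *)
From Stdlib Require Export Reals ZArith.
From Coquelicot Require Export Coquelicot.
Open Scope R_scope.

(* Functions on T = R / 2 pi Z are represented as 2pi-periodic functions on R. *)
Definition continuous_on_T (f : R -> C) : Prop :=
  (forall x : R, continuous f x) /\ (forall x : R, f (x + 2 * PI) = f x).

Definition expi (t : R) : C := (cos t, sin t).

(* C is taken with its structure of real Banach space, so the integral is the
   Riemann integral of a complex-valued function of a real variable. *)
Definition fourier_coef (f : R -> C) (k : Z) : C :=
  Cmult (RtoC (/ (2 * PI)))
    (RInt (V := C_R_CompleteNormedModule)
       (fun x : R => Cmult (f x) (expi (- (IZR k * x)))) 0 (2 * PI)).

(* f ~ sum_(k >= 0) A k x *)
Definition has_fourier_series (f : R -> C) (A : nat -> R -> C) : Prop :=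
  (forall x : R, A 0%nat x = fourier_coef f 0) /\
  (forall (k : nat) (x : R), (1 <= k)%nat ->
     A k x = Cplus
       (Cmult (fourier_coef f (Z.of_nat k)) (expi (INR k * x)))
       (Cmult (fourier_coef f (- Z.of_nat k)) (expi (- (INR k * x))))).

(* The supremum of |g|. It is an attained maximum when g is continuous and
   2pi-periodic; [real] sends an infinite supremum to 0, so the value is
   meaningful for bounded g only. *)
Definition unif_norm (g : R -> C) : R :=
  real (Lub_Rbar (fun r : R => exists x : R, r = Cmod (g x))).

(* u k = O(v k) as k -> infinity *)
Definition bigO_seq (u : nat -> C) (v : nat -> R) : Prop :=
  exists M : R, eventually (fun k : nat => Cmod (u k) <= M * Rabs (v k)).

(* Bijections of {1, 2, 3, ...}; the value at 0 is irrelevant. *)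
Definition permutation_pos (sigma : nat -> nat) : Prop :=
  (forall k : nat, (1 <= k)%nat -> (1 <= sigma k)%nat) /\
  (forall j k : nat, (1 <= j)%nat -> (1 <= k)%nat ->
     sigma j = sigma k -> j = k) /\
  (forall m : nat, (1 <= m)%nat ->
     exists k : nat, (1 <= k)%nat /\ sigma k = m).

(* Main.v *)
Require Import Defs.
From Stdlib Require Import Lra Lia List Permutation Classical IndefiniteDescription.
Import ListNotations.

(** The rearrangement is built from dyadic blocks of frequencies.  The de la
    Vallee Poussin means [2 sigma_(2N) - sigma_N] of [f] converge uniformly to
    [f].  They keep the terms of frequency at most [N = 2 ^ j] and multiply
    the term of frequency [k] in [(N, 2N]] by the fraction [(2N - k) / N].
    If these fractions can be rounded to 0 or 1 with a uniform error that
    tends to 0, one gets sets of frequencies [F_j], with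
    [{1..2^j} <= F_j <= {1..2^(j+1)}], whose partial sums converge uniformly
    to [f].  The differences of successive sets [F_j] lie in
    [(2^j, 2^(j+2)]] and their sums are uniformly small; it remains to list
    each difference so that all its prefix sums stay small too.

    Both tasks are discrepancy problems: the frequencies of a block are to be
    given signs so that the signed sum is uniformly small.  Independent random
    signs fail by a logarithmic factor.  The bound of Spencer's theorem, six
    standard deviations, has no such factor: for [n] vectors and a number of
    coordinates of order [N >= n], signs exist whose sum is of the size of one
    Euclidean norm up to a factor growing slowly in [N / n].  It applies since
    a trigonometric polynomial of degree [M] is controlled by its values at
    [4M] points ([trig_diff_sup_le_grid]).  In a block around [N] the
    coefficients are [O(N ^ (-1/2))] and, by the Bessel inequality, their
    squares have a sum [S] tending to 0.  Hence a set of [n] of them has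
    energy at most [min (S, O(n / N))], which is [O(sqrt S * sqrt (n / N))].
    The power of [n / N] absorbs the slowly growing factor and makes all the
    iterations below geometric series; the factor [sqrt S] makes the result
    tend to 0 ([balanced_splitting]).

    - [partial_coloring] signs a tenth of the vectors.  Round the coordinates
      of all [2 ^ n] signed sums to cells of a fixed width: since almost all
      cells are the central one, few cell patterns occur, some pattern is
      shared by more sign vectors than a Hamming ball contains, and half the
      difference of two distant sign vectors with that pattern is a partial
      signing with small sums.
    - [balanced_splitting] iterates this on the unsigned vectors.
    - [dyadic_rounding] rounds weights [a / 2 ^ J] one binary digit at a time:
      the last digit is removed by moving each odd weight up or down by
      [2 ^ (- J)], and the directions are the signs of a balanced splitting.
    - [small_prefix_ordering] cuts a list into halves of nearly equal sums, by
      signing differences of paired elements, and recurses: a prefix is a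
      union of one piece at each scale, and the errors decrease
      geometrically. *)

(** * Sums over lists and elementary inequalities *)

Fixpoint lsum {U : Type} (w : U -> R) (l : list U) : R :=
  match l with
  | [] => 0
  | u :: l => w u + lsum w l
  end.

Lemma lsum_app {U} (w : U -> R) l1 l2 : lsum w (l1 ++ l2) = lsum w l1 + lsum w l2.
Proof. induction l1 as [|u l1 IH]; simpl; [lra | rewrite IH; lra]. Qed.

Lemma lsum_perm {U} (w : U -> R) l1 l2 : Permutation l1 l2 -> lsum w l1 = lsum w l2.
Proof. intros H; induction H; simpl; lra. Qed.

Lemma lsum_map {U X} (g : U -> X) (w : X -> R) l :
  lsum w (map g l) = lsum (fun u => w (g u)) l.
Proof. induction l as [|u l IH]; simpl; [reflexivity | now rewrite IH]. Qed.

Lemma lsum_ext {U} (w1 w2 : U -> R) l :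
  (forall u, In u l -> w1 u = w2 u) -> lsum w1 l = lsum w2 l.
Proof.
  induction l as [|u l IH]; simpl; intros H; [reflexivity|].
  rewrite (H u) by auto. rewrite IH; auto.
Qed.

Lemma lsum_le {U} (w1 w2 : U -> R) l :
  (forall u, In u l -> w1 u <= w2 u) -> lsum w1 l <= lsum w2 l.
Proof.
  induction l as [|u l IH]; simpl; intros H; [lra|].
  apply Rplus_le_compat; auto.
Qed.

Lemma lsum_nonneg {U} (w : U -> R) l : (forall u, In u l -> 0 <= w u) -> 0 <= lsum w l.
Proof.
  induction l as [|u l IH]; simpl; intros H; [lra|].
  apply Rplus_le_le_0_compat; auto.
Qed.

Lemma lsum_plus {U} (w1 w2 : U -> R) l :
  lsum (fun u => w1 u + w2 u) l = lsum w1 l + lsum w2 l.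
Proof. induction l as [|u l IH]; simpl; [lra | rewrite IH; lra]. Qed.

Lemma lsum_minus {U} (w1 w2 : U -> R) l :
  lsum (fun u => w1 u - w2 u) l = lsum w1 l - lsum w2 l.
Proof. induction l as [|u l IH]; simpl; [lra | rewrite IH; lra]. Qed.

Lemma lsum_scal {U} c (w : U -> R) l : lsum (fun u => c * w u) l = c * lsum w l.
Proof. induction l as [|u l IH]; simpl; [lra | rewrite IH; lra]. Qed.

Lemma lsum_const {U} c (l : list U) : lsum (fun _ => c) l = INR (length l) * c.
Proof.
  induction l as [|u l IH]; [simpl; lra|].
  cbn [lsum length]. rewrite IH, S_INR. lra.
Qed.

Lemma lsum_Rabs {U} (w : U -> R) l : Rabs (lsum w l) <= lsum (fun u => Rabs (w u)) l.
Proof.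
  induction l as [|u l IH]; simpl; [rewrite Rabs_R0; lra|].
  eapply Rle_trans; [apply Rabs_triang | lra].
Qed.

Lemma lsum_exchange {U X} (w : U -> X -> R) l k :
  lsum (fun u => lsum (w u) k) l = lsum (fun x => lsum (fun u => w u x) l) k.
Proof.
  induction l as [|u l IH]; simpl.
  - induction k as [|x k IHk]; simpl; lra.
  - rewrite IH, <- lsum_plus. reflexivity.
Qed.

Lemma lsum_filter_le {U} (p : U -> bool) (w : U -> R) l :
  (forall u, In u l -> 0 <= w u) -> lsum w (filter p l) <= lsum w l.
Proof.
  induction l as [|u l IH]; simpl; intros H; [lra|].
  specialize (IH (fun u' h => H u' (or_intror h))).
  pose proof (H u (or_introl eq_refl)). destruct (p u); simpl; lra.
Qed.

Lemma lsum_single {U} (w : U -> R) l u0 :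
  NoDup l -> In u0 l -> (forall u, In u l -> u <> u0 -> w u = 0) -> lsum w l = w u0.
Proof.
  intros Hnd Hin Hz. apply in_split in Hin. destruct Hin as [l1 [l2 ->]].
  apply NoDup_remove in Hnd. destruct Hnd as [_ Hni].
  assert (G : forall k, (forall u, In u k -> In u (l1 ++ l2)) -> lsum w k = 0).
  { intros k Hk. rewrite (lsum_ext _ (fun _ => 0)); [rewrite lsum_const; ring|].
    intros u Hu. apply Hz.
    - apply Hk in Hu. rewrite in_app_iff in *. simpl; tauto.
    - intros ->. apply Hni; auto. }
  rewrite lsum_app. cbn [lsum].
  rewrite (G l1), (G l2); [ring | |]; intros; apply in_or_app; tauto.
Qed.

Lemma lsum_incl {U} (w : U -> R) T L : NoDup T -> incl T L ->
  (forall u, In u L -> 0 <= w u) -> lsum w T <= lsum w L.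
Proof.
  revert L. induction T as [|u T IH]; intros L Hnd Hin Hw.
  - now apply lsum_nonneg.
  - apply NoDup_cons_iff in Hnd. destruct Hnd as [Hu Hnd].
    destruct (in_split u L) as [L1 [L2 ->]]; [apply Hin; now left|].
    assert (H : lsum w T <= lsum w (L1 ++ L2)).
    { apply IH; [exact Hnd | |].
      - intros v Hv. assert (H : In v (L1 ++ u :: L2)) by (apply Hin; now right).
        apply in_app_or in H. apply in_or_app. destruct H as [H|[->|H]]; tauto.
      - intros v Hv. apply Hw. apply in_app_or in Hv. apply in_or_app. simpl. tauto. }
    rewrite lsum_app in *. cbn [lsum]. lra.
Qed.

Lemma list_argmax {U} (y : U -> R) l :
  l <> [] -> exists u, In u l /\ forall u', In u' l -> y u' <= y u.
Proof.
  induction l as [|u l IH]; [congruence|]. intros _.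
  destruct l as [|u1 l].
  - exists u; split; [now left|]. intros u' [<-|[]]; lra.
  - destruct IH as [v [Hv Hmax]]; [congruence|].
    destruct (Rle_lt_dec (y u) (y v)) as [H|H].
    + exists v; split; [now right|]. intros u' [<-|Hu']; auto.
    + exists u; split; [now left|]. intros u' [<-|Hu']; [lra|].
      pose proof (Hmax u' Hu'); lra.
Qed.

Lemma filter_partition {X} (p : X -> bool) l :
  Permutation l (filter p l ++ filter (fun x => negb (p x)) l).
Proof.
  induction l as [|x l IH]; simpl; [constructor|].
  destruct (p x); simpl; [now constructor | now apply Permutation_cons_app].
Qed.

Lemma exp_le_exp a b : a <= b -> exp a <= exp b.
Proof. intros [H| ->]; [now apply Rlt_le, exp_increasing | lra]. Qed.

Lemma exp_pow a n : exp a ^ n = exp (INR n * a).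
Proof.
  induction n as [|n IH]; [simpl; now rewrite Rmult_0_l, exp_0|].
  rewrite S_INR. simpl pow. rewrite IH, <- exp_plus. f_equal; ring.
Qed.

Lemma pow_le_reg k a b : (1 <= k)%nat -> 0 <= b -> a ^ k <= b ^ k -> a <= b.
Proof.
  intros Hk Hb H. apply Rnot_lt_le. intros Hlt.
  assert (b ^ k < a ^ k); [|lra].
  clear H. induction k as [|k IH]; [lia|]. simpl.
  destruct k as [|k]; [simpl; lra|].
  specialize (IH ltac:(lia)). assert (0 <= b ^ S k) by (apply pow_le; lra). nra.
Qed.

(** * Random signs *)

Fixpoint signs (n : nat) : list (list bool) :=
  match n with
  | 0%nat => [[]]
  | S n => map (cons true) (signs n) ++ map (cons false) (signs n)
  end.

Lemma signs_length n : INR (length (signs n)) = 2 ^ n.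
Proof.
  induction n as [|n IH]; [simpl; lra|].
  cbn [signs]. rewrite length_app, !length_map, plus_INR, IH. simpl; lra.
Qed.

Lemma in_signs n x : In x (signs n) -> length x = n.
Proof.
  revert x; induction n as [|n IH]; simpl; intros x.
  - intros [<-|[]]; reflexivity.
  - rewrite in_app_iff, !in_map_iff.
    intros [[y [<- Hy]]|[y [<- Hy]]]; simpl; auto.
Qed.

(** [dot x l w] is the sum of [w] over [l] with the signs [x], where [true] is
    read as [+1]. *)
Fixpoint dot {U : Type} (x : list bool) (l : list U) (w : U -> R) : R :=
  match x, l with
  | b :: x, u :: l => (if b then w u else - w u) + dot x l w
  | _, _ => 0
  end.

(** The factor 2 in the exponent, instead of the optimal 1/2, allows a proof
    from [1 + u <= exp u] alone: for small [u], [exp u <= 1 / (1 - u)]. *)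
Lemma cosh_le_exp u : exp u + exp (- u) <= 2 * exp (2 * (u * u)).
Proof.
  destruct (Rle_lt_dec (u * u) (1/2)) as [H|H].
  - pose proof (exp_ineq1_le u). pose proof (exp_ineq1_le (- u)).
    assert (-1 < u < 1) by (split; nra).
    assert (E : exp u * exp (- u) = 1) by (rewrite <- exp_plus; rewrite Rplus_opp_r; apply exp_0).
    pose proof (exp_pos u). pose proof (exp_pos (- u)).
    assert (exp u * (1 - u) <= 1) by nra.
    assert (exp (- u) * (1 + u) <= 1) by nra.
    assert ((exp u + exp (- u)) * (1 - u * u) <= 2) by nra.
    pose proof (exp_ineq1_le (2 * (u * u))).
    assert (exp u + exp (- u) <= 2 * (1 + 2 * (u * u))); [|lra].
    apply (Rmult_le_reg_r (1 - u * u)); nra.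
  - assert (Hm : forall z, z * z = u * u -> exp z <= exp (2 * (u * u))).
    { intros z Hz. destruct (Req_dec z (2 * (u*u))) as [->|Hne]; [lra|].
      apply Rlt_le, exp_increasing. nra. }
    pose proof (Hm u eq_refl). pose proof (Hm (- u) ltac:(ring)). lra.
Qed.

(** The exponential moment of a sum of independent signs factorizes, and each
    factor is a hyperbolic cosine. *)
Lemma signs_moment {U} (w : U -> R) lam l :
  lsum (fun x => exp (lam * dot x l w)) (signs (length l))
  <= 2 ^ length l * exp (2 * lam ^ 2 * lsum (fun u => w u ^ 2) l).
Proof.
  induction l as [|u l IH].
  - simpl. rewrite !Rmult_0_r, exp_0. lra.
  - cbn [length signs]. rewrite lsum_app, !lsum_map. cbn [dot lsum].
    rewrite (lsum_ext _ (fun x => exp (lam * w u) * exp (lam * dot x l w)))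
      by (intros x _; rewrite <- exp_plus; f_equal; ring).
    rewrite (lsum_ext (fun x => exp (lam * (- w u + _)))
      (fun x => exp (- (lam * w u)) * exp (lam * dot x l w)))
      by (intros x _; rewrite <- exp_plus; f_equal; ring).
    rewrite !lsum_scal, <- Rmult_plus_distr_r.
    eapply Rle_trans.
    + apply Rmult_le_compat; [ | | apply cosh_le_exp | apply IH].
      * pose proof (exp_pos (lam * w u)). pose proof (exp_pos (- (lam * w u))). lra.
      * apply lsum_nonneg. intros; apply Rlt_le, exp_pos.
    + apply Req_le.
      replace (2 * lam ^ 2 * (w u ^ 2 + lsum (fun u0 => w u0 ^ 2) l))
        with (2 * (lam * w u * (lam * w u)) + 2 * lam ^ 2 * lsum (fun u0 => w u0 ^ 2) l) by ring.
      rewrite exp_plus. simpl. ring.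
Qed.

(** * Partial colourings *)

(** The index of the cell of width [2 D], centred at an integer multiple of
    [2 D], that contains [s]. *)
Definition cell (D s : R) : Z := Int_part ((s + D) / (2 * D)).

Lemma cell_spec D s : 0 < D -> Rabs (s - 2 * D * IZR (cell D s)) <= D.
Proof.
  intros HD. unfold cell. destruct (base_Int_part ((s + D) / (2 * D))) as [H1 H2].
  set (z := IZR (Int_part _)) in *.
  assert (E : (s + D) / (2 * D) * (2 * D) = s + D) by (field; lra).
  apply Rabs_le. split; nra.
Qed.

(** The cell index vanishes for [|s| < D] and never exceeds [|s| / D], so it is
    dominated by an exponential in [|s|] with a small constant in front; the
    mean over all signs is then an exponential moment. *)
Lemma cell_tail D lam s : 0 < D -> 1 <= lam * D ->
  Rabs (IZR (cell D s)) <= exp (- (lam * D)) * (exp (lam * s) + exp (- lam * s)).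
Proof.
  intros HD Hl. pose proof (cell_spec D s HD) as H.
  set (z := cell D s) in *.
  pose proof (exp_pos (- (lam * D))) as P0.
  pose proof (exp_pos (lam * s)) as P1. pose proof (exp_pos (- lam * s)) as P2.
  assert (G : forall r y, 1 <= y -> y * D <= r ->
     y <= exp (- (lam * D)) * exp (lam * r)).
  { intros r y Hy Hr. rewrite <- exp_plus.
    pose proof (exp_ineq1_le (- (lam * D) + lam * r)) as E.
    assert (0 < lam) by nra.
    assert (lam * r >= lam * D * y) by nra. nra. }
  apply Rabs_le_between in H.
  destruct (Z_lt_le_dec 0 z) as [Hz|Hz]; [|destruct (Z_lt_le_dec z 0) as [Hz'|Hz']].
  - assert (1 <= IZR z) by (apply IZR_le; lia).
    rewrite Rabs_right by lra.
    pose proof (G s (IZR z) ltac:(lra) ltac:(nra)). nra.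
  - assert (IZR z <= -1) by (apply IZR_le; lia).
    rewrite Rabs_left by lra.
    pose proof (G (- s) (- IZR z) ltac:(lra) ltac:(nra)) as E.
    replace (lam * - s) with (- lam * s) in E by ring. nra.
  - replace z with 0%Z by lia. rewrite Rabs_R0. nra.
Qed.

Fixpoint zrange (B : nat) : list Z :=
  match B with
  | 0%nat => [0%Z]
  | S B => Z.of_nat (S B) :: (- Z.of_nat (S B))%Z :: zrange B
  end.

Lemma in_zrange B z : (Z.abs z <= Z.of_nat B)%Z -> In z (zrange B).
Proof.
  induction B as [|B IH]; intros H; cbn [zrange].
  - left; lia.
  - destruct (Z.eq_dec z (Z.of_nat (S B))) as [->|]; [now left|].
    destruct (Z.eq_dec z (- Z.of_nat (S B))) as [->|]; [right; now left|].
    right; right; apply IH; lia.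
Qed.

Lemma zrange_sum L B : 0 < L ->
  lsum (fun z => exp (- L * Rabs (IZR z))) (zrange B) <= exp (2 / L).
Proof.
  intros HL. eapply Rle_trans; [|apply exp_ineq1_le].
  assert (forall B, lsum (fun z => exp (- L * Rabs (IZR z))) (zrange B)
            <= 1 + 2 / L * (1 - exp (- L * INR B))) as H.
  { clear B. induction B as [|B IH].
    - simpl. rewrite Rabs_R0, !Rmult_0_r, exp_0. lra.
    - cbn [zrange lsum]. rewrite opp_IZR, Rabs_Ropp, <- INR_IZR_INZ.
      rewrite Rabs_right by (apply Rle_ge, pos_INR).
      enough (exp (- L * INR (S B)) * 2 <= 2 / L * (exp (- L * INR B) - exp (- L * INR (S B)))) by lra.
      replace (- L * INR B) with (L + - L * INR (S B)) by (rewrite S_INR; ring).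
      rewrite exp_plus.
      pose proof (exp_pos (- L * INR (S B))). pose proof (exp_ineq1_le L).
      replace (2 / L * (exp L * exp (- L * INR (S B)) - exp (- L * INR (S B))))
        with (exp (- L * INR (S B)) * 2 * ((exp L - 1) / L)) by (field; lra).
      assert (1 <= (exp L - 1) / L) by (apply Rle_div_r; lra).
      nra. }
  specialize (H B). pose proof (exp_pos (- L * INR B)).
  assert (0 < 2 / L) by (apply Rdiv_lt_0_compat; lra). nra.
Qed.

(** A pigeonhole principle in which the class [u] has prior weight [p u]: this
    favours the classes that are expected to be large. *)
Lemma lsum_weighted_pigeonhole {U} (p y : U -> R) l Z :
  l <> [] -> (forall u, In u l -> 0 <= p u) -> (forall u, In u l -> 0 <= y u) ->
  lsum p l <= Z -> exists u, In u l /\ lsum (fun u => p u * y u) l <= y u * Z.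
Proof.
  intros Hl Hp Hy HZ. destruct (list_argmax y l Hl) as [u [Hu Hmax]].
  exists u; split; [exact Hu|].
  apply Rle_trans with (y u * lsum p l).
  - rewrite <- lsum_scal. apply lsum_le. intros u' Hu'.
    pose proof (Hp u' Hu'). pose proof (Hmax u' Hu'). nra.
  - apply Rmult_le_compat_l; auto.
Qed.

Lemma lsum_classes {X} (b : X -> Z) (w : X -> R) (cs : list Z) X0 :
  (forall x, In x X0 -> 0 <= w x) -> (forall x, In x X0 -> In (b x) cs) ->
  lsum w X0 <= lsum (fun c => lsum w (filter (fun x => Z.eqb (b x) c) X0)) cs.
Proof.
  induction X0 as [|x X0 IH]; intros Hw Hb; simpl.
  - apply lsum_nonneg; intros; lra.
  - specialize (IH (fun x' h => Hw x' (or_intror h)) (fun x' h => Hb x' (or_intror h))).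
    pose proof (Hb x (or_introl eq_refl)) as Hin. apply in_split in Hin.
    destruct Hin as [c1 [c2 E]]. rewrite E in *. rewrite lsum_app in *. cbn [lsum] in *.
    rewrite Z.eqb_refl. cbn [lsum].
    assert (G : forall k, lsum (fun c => lsum w (filter (fun x0 => Z.eqb (b x0) c) X0)) k <=
       lsum (fun c => lsum w (if Z.eqb (b x) c then x :: filter (fun x0 => Z.eqb (b x0) c) X0
                 else filter (fun x0 => Z.eqb (b x0) c) X0)) k).
    { intros k. apply lsum_le. intros c _. pose proof (Hw x (or_introl eq_refl)).
      destruct (Z.eqb (b x) c); simpl; lra. }
    pose proof (G c1). pose proof (G c2). lra.
Qed.

(** The geometric weights [exp (- L |z|)] on the integers have total mass
    at most [exp (2 / L)], barely more than the mass 1 of the central cell.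
    Fixing the coordinates one after the other by the weighted pigeonhole
    principle costs this factor per coordinate, so that a class of constant
    cell pattern survives whose size is nearly the sum of the pattern
    weights over [X0]. *)
Lemma cells_pigeonhole {X} (b : nat -> X -> Z) L B m (X0 : list X) :
  0 < L -> (forall t x, (t < m)%nat -> In x X0 -> (Z.abs (b t x) <= Z.of_nat B)%Z) ->
  exists p : X -> bool,
    (forall t x y, (t < m)%nat -> In x (filter p X0) -> In y (filter p X0) -> b t x = b t y) /\
    lsum (fun x => exp (- L * lsum (fun t => Rabs (IZR (b t x))) (seq 0 m))) X0
      <= INR (length (filter p X0)) * exp (2 / L * INR m).
Proof.
  intros HL. revert X0. induction m as [|m IH]; intros X0 HB.
  - exists (fun _ => true). split; [lia|]. simpl.
    rewrite !Rmult_0_r, exp_0, lsum_const.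
    replace (filter _ X0) with X0; [lra|].
    clear. induction X0; simpl; congruence.
  - set (w := fun x => exp (- L * lsum (fun t => Rabs (IZR (b t x))) (seq 0 m))).
    destruct (lsum_weighted_pigeonhole (fun c => exp (- L * Rabs (IZR c)))
      (fun c => lsum w (filter (fun x => Z.eqb (b m x) c) X0)) (zrange B) (exp (2 / L)))
      as [c [_ Hc]].
    + destruct B; simpl; congruence.
    + intros; apply Rlt_le, exp_pos.
    + intros; apply lsum_nonneg; intros; apply Rlt_le, exp_pos.
    + apply zrange_sum; exact HL.
    + destruct (IH (filter (fun x => Z.eqb (b m x) c) X0)) as [p [Hp1 Hp2]].
      { intros t x Ht Hx. apply filter_In in Hx. apply HB; [lia | tauto]. }
      exists (fun x => Z.eqb (b m x) c && p x)%bool.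
      assert (E : filter (fun x => Z.eqb (b m x) c && p x)%bool X0
        = filter p (filter (fun x => Z.eqb (b m x) c) X0)).
      { clear. induction X0 as [|x X0 IH]; simpl; [reflexivity|].
        destruct (Z.eqb (b m x) c); simpl; [|exact IH].
        destruct (p x); simpl; congruence. }
      rewrite E. split.
      * intros t x y Ht Hx Hy. destruct (Nat.eq_dec t m) as [->|].
        -- apply filter_In in Hx, Hy. destruct Hx as [Hx _], Hy as [Hy _].
           apply filter_In in Hx, Hy. destruct Hx as [_ Hx], Hy as [_ Hy].
           apply Z.eqb_eq in Hx, Hy. congruence.
        -- apply Hp1; auto; lia.
      * apply Rle_trans with (lsum (fun c => exp (- L * Rabs (IZR c)) *
           lsum w (filter (fun x => Z.eqb (b m x) c) X0)) (zrange B)).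
        -- eapply Rle_trans; [apply (lsum_classes (b m) _ (zrange B))|].
           ++ intros; apply Rlt_le, exp_pos.
           ++ intros x Hx. apply in_zrange, HB; [lia | exact Hx].
           ++ apply lsum_le. intros c' _. rewrite <- lsum_scal. apply lsum_le.
              intros x Hx. apply filter_In in Hx. destruct Hx as [_ Hx].
              apply Z.eqb_eq in Hx. unfold w. rewrite <- exp_plus. apply Req_le. f_equal.
              rewrite seq_S, lsum_app. cbn [lsum]. rewrite <- Hx. simpl. ring.
        -- eapply Rle_trans; [exact Hc|].
           rewrite S_INR.
           replace (2 / L * (INR m + 1)) with (2 / L * INR m + 2 / L) by ring.
           rewrite exp_plus, <- Rmult_assoc.
           apply Rmult_le_compat_r; [apply Rlt_le, exp_pos | exact Hp2].
Qed.

Fixpoint ham (x y : list bool) : nat :=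
  match x, y with
  | a :: x, b :: y => ((if Bool.eqb a b then 0 else 1) + ham x y)%nat
  | _, _ => 0%nat
  end.

(** The generating function of the distances to a fixed sign vector; it bounds
    the size of Hamming balls by Markov's inequality. *)
Lemma ham_generating n z y : length y = n ->
  lsum (fun x => z ^ ham x y) (signs n) = (1 + z) ^ n.
Proof.
  revert y. induction n as [|n IH]; intros [|b y] Hy; try discriminate.
  - simpl; lra.
  - cbn [signs]. rewrite lsum_app, !lsum_map. injection Hy as Hy.
    destruct b; cbn [ham Bool.eqb]; simpl pow.
    + rewrite lsum_scal. cbn. rewrite (IH y Hy). ring.
    + rewrite lsum_scal. cbn. rewrite (IH y Hy). ring.
Qed.

(** Half the difference of two sign vectors has entries in [{-1, 0, 1}]: [P], [Q]
    and [W] collect the elements with entry 1, -1 and 0. *)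
Lemma sign_difference_split {U} (l : list U) x y :
  length x = length l -> length y = length l ->
  exists P Q W, Permutation l (P ++ Q ++ W) /\ (length P + length Q = ham x y)%nat /\
    forall w, dot x l w - dot y l w = 2 * (lsum w P - lsum w Q).
Proof.
  revert x y. induction l as [|u l IH]; intros [|a x] [|b y] Hx Hy; try discriminate.
  - exists [], [], []. split; [constructor|]. split; [reflexivity|]. intros; simpl; lra.
  - injection Hx as Hx; injection Hy as Hy.
    destruct (IH x y Hx Hy) as [P [Q [W [H1 [H2 H3]]]]].
    destruct a, b; cbn [ham Bool.eqb dot].
    + exists P, Q, (u :: W). split; [|split; [exact H2|intros w; rewrite <- H3; ring]].
      rewrite app_assoc. apply Permutation_cons_app. now rewrite <- app_assoc.
    + exists (u :: P), Q, W. split; [now constructor|]. split; [simpl; lia|].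
      intros w; specialize (H3 w); cbn [lsum]; lra.
    + exists P, (u :: Q), W. split; [now apply Permutation_cons_app|]. split; [simpl; lia|].
      intros w; specialize (H3 w); cbn [lsum]; lra.
    + exists P, Q, (u :: W). split; [|split; [exact H2|intros w; rewrite <- H3; ring]].
      rewrite app_assoc. apply Permutation_cons_app. now rewrite <- app_assoc.
Qed.

(** A Hamming ball of radius [n / 10] has fewer than [(3 / 2) ^ n] points: with
    [z = (4 / 5) ^ 10] each point of the ball contributes at least
    [(4 / 5) ^ n] to the generating function [(1 + z) ^ n], and
    [1 + z < 6 / 5]. *)
Lemma far_pair n X1 p :
  (1 <= n)%nat -> X1 = filter p (signs n) -> (3 / 2) ^ n <= INR (length X1) ->
  exists x y, In x X1 /\ In y X1 /\ (n <= 10 * ham x y)%nat.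
Proof.
  intros Hn HX Hc.
  destruct X1 as [|y X'] eqn:EX.
  { simpl in Hc. assert (0 < (3/2) ^ n) by (apply pow_lt; lra). lra. }
  rewrite <- EX in *. assert (Hy : In y X1) by (rewrite EX; now left).
  apply NNPP; intros Hno.
  assert (Hclose : forall x, In x X1 -> (10 * ham x y <= n)%nat).
  { intros x Hx. apply Nat.nlt_ge. intros Hlt. apply Hno. exists x, y. repeat split; auto; lia. }
  (* This [z] makes [z ^ (n / 10)] the integral power [(4 / 5) ^ n]. *)
  set (z := (4 / 5) ^ 10).
  assert (H1 : (4 / 5) ^ n * INR (length X1) <= (1 + z) ^ n).
  { rewrite <- (ham_generating n z y).
    2:{ apply in_signs. rewrite HX in Hy. apply filter_In in Hy. tauto. }
    eapply Rle_trans; [|apply (lsum_filter_le p)].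
    2:{ intros; apply pow_le; unfold z; apply pow_le; lra. }
    rewrite <- HX, Rmult_comm, <- (lsum_const ((4/5) ^ n) X1).
    apply lsum_le. intros x Hx. unfold z. rewrite <- pow_mult.
    specialize (Hclose x Hx).
    replace n with (10 * ham x y + (n - 10 * ham x y))%nat at 1 by lia.
    rewrite pow_add.
    assert (0 < (4/5) ^ (10 * ham x y)) by (apply pow_lt; lra).
    assert ((4/5) ^ (n - 10 * ham x y) <= 1).
    { rewrite <- (pow1 (n - 10 * ham x y)). apply pow_incr; lra. }
    nra. }
  assert (H2 : (4 / 5 * (3 / 2)) ^ n <= (1 + z) ^ n).
  { rewrite Rpow_mult_distr. assert (0 < (4/5) ^ n) by (apply pow_lt; lra). nra. }
  assert (H3 : (1 + z) ^ n < (4 / 5 * (3 / 2)) ^ n); [|lra].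
  destruct n as [|n]; [lia|].
  assert (0 < z) by (unfold z; apply pow_lt; lra).
  assert (z < 1 / 5) by (unfold z; simpl; lra).
  assert ((1 + z) ^ n <= (4 / 5 * (3 / 2)) ^ n) by (apply pow_incr; lra).
  assert (0 < (1 + z) ^ n) by (apply pow_lt; lra).
  simpl. nra.
Qed.

(** Jensen's inequality for the exponential, from the tangent line at [- a]. *)
Lemma jensen_exp {X} (g : X -> R) l a :
  lsum g l <= INR (length l) * a ->
  INR (length l) * exp (- a) <= lsum (fun x => exp (- g x)) l.
Proof.
  intros H.
  apply Rle_trans with (lsum (fun x => exp (- a) * (1 + a) + - exp (- a) * g x) l).
  - rewrite lsum_plus, lsum_const, lsum_scal.
    pose proof (exp_pos (- a)). nra.
  - apply lsum_le. intros x _.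
    replace (- g x) with (- a + (a - g x)) by ring. rewrite exp_plus.
    pose proof (exp_ineq1_le (a - g x)). pose proof (exp_pos (- a)). nra.
Qed.

(** Choosing [lam = D / (4 V)] balances the decay [exp (- lam D)] of the tail
    bound against the moment [exp (2 lam ^ 2 V)]. *)
Lemma cell_mean_tail {U} (w : U -> R) l V D :
  0 < V -> 0 < D -> 4 * V <= D ^ 2 -> lsum (fun u => w u ^ 2) l <= V ->
  lsum (fun x => Rabs (IZR (cell D (dot x l w)))) (signs (length l))
  <= 2 ^ length l * (2 * exp (- (D ^ 2 / (8 * V)))).
Proof.
  intros HV HD HVD Hw. set (lam := D / (4 * V)).
  assert (Hl : lam * D = D ^ 2 / (4 * V)) by (unfold lam; field; lra).
  apply Rle_trans with (lsum (fun x => exp (- (lam * D)) * (exp (lam * dot x l w)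
      + exp (- lam * dot x l w))) (signs (length l))).
  - apply lsum_le. intros x _. apply cell_tail; [exact HD|].
    rewrite Hl. apply Rle_div_r; lra.
  - rewrite lsum_scal, lsum_plus.
    pose proof (signs_moment w lam l) as H1. pose proof (signs_moment w (- lam) l) as H2.
    replace ((- lam) ^ 2) with (lam ^ 2) in H2 by ring.
    assert (E : exp (2 * lam ^ 2 * lsum (fun u => w u ^ 2) l) <= exp (2 * lam ^ 2 * V)).
    { apply exp_le_exp. apply Rmult_le_compat_l; [nra | exact Hw]. }
    replace (exp (- (D ^ 2 / (8 * V)))) with (exp (- (lam * D)) * exp (2 * lam ^ 2 * V)).
    2:{ rewrite <- exp_plus. f_equal. unfold lam. field. lra. }
    assert (0 < 2 ^ length l) by (apply pow_lt; lra).
    pose proof (exp_pos (- (lam * D))).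
    replace (2 ^ length l * (2 * (exp (- (lam * D)) * exp (2 * lam ^ 2 * V))))
      with (exp (- (lam * D)) * (2 * (2 ^ length l * exp (2 * lam ^ 2 * V)))) by ring.
    apply Rmult_le_compat_l; [lra|]. nra.
Qed.

Lemma cells_bounded {U} (l : list U) (w : nat -> U -> R) D m :
  exists B, forall t x, (t < m)%nat -> In x (signs (length l)) ->
    (Z.abs (cell D (dot x l (w t))) <= Z.of_nat B)%Z.
Proof.
  assert (G : forall (X : Type) (b : nat -> X -> Z) (l0 : list X) m, exists B, forall t x,
    (t < m)%nat -> In x l0 -> (Z.abs (b t x) <= Z.of_nat B)%Z).
  { clear. intros X b l0 m. induction m as [|m [B HB]]; [exists 0%nat; lia|].
    assert (exists B1, forall x, In x l0 -> (Z.abs (b m x) <= Z.of_nat B1)%Z) as [B1 HB1].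
    { clear. induction l0 as [|x l0 [B HB]]; [exists 0%nat; simpl; tauto|].
      exists (B + Z.abs_nat (b m x))%nat. intros y [<-|Hy]; [lia|].
      specialize (HB y Hy). lia. }
    exists (B + B1)%nat. intros t x Ht Hx. destruct (Nat.eq_dec t m) as [->|].
    - specialize (HB1 x Hx). lia.
    - specialize (HB t x ltac:(lia) Hx). lia. }
  destruct (G _ (fun t x => cell D (dot x l (w t))) (signs (length l)) m) as [B HB].
  exists B. exact HB.
Qed.

(** The first term in the entropy condition is [L] times a bound on the mean of
    the cell indices over all signs; the second is the logarithmic cost
    of the geometric weights in [cells_pigeonhole].  Together they let
    a cell pattern lose at most a factor [exp (- n / 4) >= (3 / 4) ^ n]
    from the [2 ^ n] sign vectors.  Two vectors of one cell pattern have sums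
    that differ by at most [2 D]. *)
Lemma partial_coloring {U} (l : list U) (w : nat -> U -> R) m V D L :
  (1 <= length l)%nat -> 0 < V -> 0 < D -> 0 < L -> 4 * V <= D ^ 2 ->
  (forall t, (t < m)%nat -> lsum (fun u => w t u ^ 2) l <= V) ->
  INR m * (2 * L * exp (- (D ^ 2 / (8 * V))) + 2 / L) <= INR (length l) / 4 ->
  exists P Q W, Permutation l (P ++ Q ++ W) /\
    (length l <= 10 * (length P + length Q))%nat /\
    forall t, (t < m)%nat -> Rabs (lsum (w t) P - lsum (w t) Q) <= D.
Proof.
  intros Hl HV HD HL HVD Hw Hm. set (n := length l) in *.
  destruct (cells_bounded l w D m) as [B HB].
  destruct (cells_pigeonhole (fun t x => cell D (dot x l (w t))) L B m (signs n) HL HB)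
    as [p [Hp1 Hp2]].
  assert (Hbig : (3 / 2) ^ n <= INR (length (filter p (signs n)))).
  { set (a := INR m * (2 * L * exp (- (D ^ 2 / (8 * V))))) in *.
    assert (Hj : 2 ^ n * exp (- a) <= INR (length (filter p (signs n))) * exp (2 / L * INR m)).
    { eapply Rle_trans; [|exact Hp2]. rewrite <- signs_length.
      rewrite (lsum_ext _ (fun x => exp (- (L * lsum (fun t =>
        Rabs (IZR (cell D (dot x l (w t))))) (seq 0 m))))) by (intros; f_equal; ring).
      apply jensen_exp. rewrite lsum_scal, lsum_exchange, signs_length.
      apply Rle_trans with (L * lsum (fun _ => 2 ^ n * (2 * exp (- (D ^ 2 / (8 * V))))) (seq 0 m)).
      - apply Rmult_le_compat_l; [lra|]. apply lsum_le. intros t Ht. apply in_seq in Ht.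
        apply cell_mean_tail; auto. apply Hw; lia.
      - rewrite lsum_const, length_seq. unfold a. apply Req_le; ring. }
    assert (Hq : (3 / 4) ^ n <= exp (- (a + 2 / L * INR m))).
    { apply Rle_trans with (exp (- (1/4)) ^ n).
      - apply pow_incr. pose proof (exp_ineq1_le (- (1/4))). lra.
      - rewrite exp_pow. apply exp_le_exp. unfold a. lra. }
    replace (3 / 2) with (2 * (3 / 4)) by lra. rewrite Rpow_mult_distr.
    assert (0 < 2 ^ n) by (apply pow_lt; lra).
    pose proof (exp_pos (2 / L * INR m)) as He.
    apply (Rmult_le_reg_r (exp (2 / L * INR m))); [exact He|].
    eapply Rle_trans; [|exact Hj].
    replace (exp (- a)) with (exp (- (a + 2 / L * INR m)) * exp (2 / L * INR m))
      by (rewrite <- exp_plus; f_equal; ring).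
    rewrite <- Rmult_assoc. apply Rmult_le_compat_r; [lra|].
    apply Rmult_le_compat_l; lra. }
  destruct (far_pair n _ p Hl eq_refl Hbig) as [x [y [Hx [Hy Hxy]]]].
  assert (Lx : length x = length l) by (apply in_signs; apply filter_In in Hx; tauto).
  assert (Ly : length y = length l) by (apply in_signs; apply filter_In in Hy; tauto).
  destruct (sign_difference_split l x y Lx Ly) as [P [Q [W [H1 [H2 H3]]]]].
  exists P, Q, W. split; [exact H1|]. split; [lia|].
  intros t Ht. specialize (H3 (w t)). specialize (Hp1 t x y Ht Hx Hy).
  pose proof (cell_spec D (dot x l (w t)) HD) as Cx.
  pose proof (cell_spec D (dot y l (w t)) HD) as Cy.
  cbv beta in Hp1. rewrite <- Hp1 in Cy.
  apply Rabs_le_between in Cx, Cy. apply Rabs_le. lra.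
Qed.

(** * Balanced splitting, rounding and ordering *)

(** The eighth root.  With [s = rt8 (n / N)] the energy of [n] vectors is of
    order [s ^ 4] and the width allowed to a colouring is of order [s], so the
    squared width exceeds the energy by a factor [s ^ (-2)]; this pays for
    the polynomial factors in [N / n] of the entropy condition. *)
Definition rt8 (x : R) : R := sqrt (sqrt (sqrt x)).

Lemma rt8_nonneg x : 0 <= rt8 x.
Proof. apply sqrt_pos. Qed.

Lemma rt8_pow x : 0 <= x -> rt8 x ^ 8 = x.
Proof.
  intros H. unfold rt8.
  replace (sqrt (sqrt (sqrt x)) ^ 8) with (((sqrt (sqrt (sqrt x)) ^ 2) ^ 2) ^ 2) by ring.
  rewrite !pow2_sqrt; auto using sqrt_pos.
Qed.

Lemma rt8_scale c x y : 0 <= c -> 0 <= x -> 0 <= y -> x <= c ^ 8 * y -> rt8 x <= c * rt8 y.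
Proof.
  intros Hc Hx Hy H. apply (pow_le_reg 8); [lia| |].
  - apply Rmult_le_pos; [exact Hc | apply rt8_nonneg].
  - rewrite Rpow_mult_distr, !rt8_pow by assumption. exact H.
Qed.

(** The hypotheses on the coefficients in a block of about [N] frequencies; they
    pass to sublists, so each iteration below can reuse them. *)
Definition spread {U} (w : nat -> U -> R) (m : nat) (N S b : R) (l : list U) : Prop :=
  INR (length l) <= N /\
  (forall t, (t < m)%nat -> lsum (fun u => w t u ^ 2) l <= S) /\
  (forall t u, (t < m)%nat -> In u l -> w t u ^ 2 <= b / N).

Lemma spread_sub {U} (w : nat -> U -> R) m N S b l l' r :
  Permutation l (l' ++ r) -> spread w m N S b l -> spread w m N S b l'.
Proof.
  intros Hp [H1 [H2 H3]]. split; [|split].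
  - eapply Rle_trans; [|exact H1]. apply le_INR.
    rewrite (Permutation_length Hp), length_app. lia.
  - intros t Ht. eapply Rle_trans; [|exact (H2 t Ht)].
    rewrite (lsum_perm _ _ _ Hp), lsum_app.
    assert (0 <= lsum (fun u => w t u ^ 2) r) by (apply lsum_nonneg; intros; apply pow2_ge_0).
    lra.
  - intros t u Ht Hu. apply H3; [exact Ht|].
    apply (Permutation_in u (Permutation_sym Hp)), in_or_app; now left.
Qed.

(** The minimum of the bounds [S] and [b * n / N] is at most their geometric
    mean. *)
Lemma spread_energy {U} (w : nat -> U -> R) m N S b l t :
  0 < N -> 0 < S -> 0 < b -> spread w m N S b l -> (t < m)%nat ->
  lsum (fun u => w t u ^ 2) l <= sqrt (S * b) * rt8 (INR (length l) / N) ^ 4.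
Proof.
  intros HN HS Hb [H1 [H2 H3]] Ht.
  assert (Hr : 0 <= INR (length l) / N)
    by (apply Rmult_le_pos; [apply pos_INR | apply Rlt_le, Rinv_0_lt_compat, HN]).
  assert (Hx : lsum (fun u => w t u ^ 2) l <= b * (INR (length l) / N)).
  { replace (b * (INR (length l) / N)) with (INR (length l) * (b / N)) by (field; lra).
    rewrite <- lsum_const. apply lsum_le. auto. }
  specialize (H2 t Ht).
  assert (0 <= lsum (fun u => w t u ^ 2) l) by (apply lsum_nonneg; intros; apply pow2_ge_0).
  apply (pow_le_reg 2); [lia| |].
  - apply Rmult_le_pos; [apply sqrt_pos | apply pow_le, rt8_nonneg].
  - rewrite Rpow_mult_distr, pow2_sqrt by nra. rewrite <- pow_mult, rt8_pow by exact Hr. nra.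
Qed.

(** The unit in which the discrepancies below are measured; it tends to 0 with
    the energy [S]. *)
Definition disc (M0 S b : R) : R := sqrt (128 * M0 * sqrt (S * b)).

Lemma disc_sqr M0 S b : 1 <= M0 -> disc M0 S b ^ 2 = 128 * M0 * sqrt (S * b).
Proof. intros H. apply pow2_sqrt. pose proof (sqrt_pos (S * b)). nra. Qed.

Lemma disc_pos M0 S b : 1 <= M0 -> 0 < S -> 0 < b -> 0 < disc M0 S b.
Proof.
  intros H HS Hb. apply sqrt_lt_R0.
  assert (0 < sqrt (S * b)) by (apply sqrt_lt_R0; nra). nra.
Qed.

(** An exponential of [s ^ (-2)] dominates the power [s ^ (-16)]: the eighth
    power of [1 + u <= exp u]. *)
Lemma coloring_entropy_bound M0 s : 1 <= M0 -> 0 < s ->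
  256 * M0 ^ 2 * exp (- (16 * M0 / s ^ 2)) <= s ^ 16.
Proof.
  intros HM Hs.
  assert (Hs2 : 0 < s ^ 2) by (apply pow_lt; lra).
  assert (H : (2 * M0 / s ^ 2) ^ 8 <= exp (16 * M0 / s ^ 2)).
  { replace (16 * M0 / s ^ 2) with (INR 8 * (2 * M0 / s ^ 2)) by (simpl; field; lra).
    rewrite <- exp_pow. apply pow_incr. split.
    - apply Rlt_le, Rdiv_lt_0_compat; lra.
    - pose proof (exp_ineq1_le (2 * M0 / s ^ 2)). lra. }
  rewrite exp_Ropp.
  pose proof (exp_pos (16 * M0 / s ^ 2)) as He.
  apply (Rmult_le_reg_r (exp (16 * M0 / s ^ 2))); [exact He|].
  replace (256 * M0 ^ 2 * / exp (16 * M0 / s ^ 2) * exp (16 * M0 / s ^ 2))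
    with (256 * M0 ^ 2) by (field; lra).
  apply Rle_trans with (s ^ 16 * (2 * M0 / s ^ 2) ^ 8).
  - replace (s ^ 16 * (2 * M0 / s ^ 2) ^ 8) with (256 * (M0 ^ 2 * M0 ^ 6)) by (field; lra).
    assert (1 <= M0 ^ 6) by (apply pow_R1_Rle; lra).
    assert (0 < M0 ^ 2) by (apply pow_lt; lra). nra.
  - apply Rmult_le_compat_l; [apply pow_le; lra | exact H].
Qed.

(** The instance [V = sqrt (S b) s ^ 4], [D = disc * s], [L = 16 M0 / s ^ 8] of
    [partial_coloring], with [s = rt8 (n / N)]. *)
Lemma spread_partial_coloring {U} (l : list U) (w : nat -> U -> R) m M0 N S b :
  1 <= M0 -> 0 < N -> 0 < S -> 0 < b -> INR m <= M0 * N ->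
  spread w m N S b l -> (1 <= length l)%nat ->
  exists P Q W, Permutation l (P ++ Q ++ W) /\
    (length l <= 10 * (length P + length Q))%nat /\
    forall t, (t < m)%nat ->
      Rabs (lsum (w t) P - lsum (w t) Q) <= disc M0 S b * rt8 (INR (length l) / N).
Proof.
  intros HM HN HS Hb Hm Hsp Hl.
  assert (Hn : 1 <= INR (length l)) by (apply (le_INR 1); exact Hl).
  set (s := rt8 (INR (length l) / N)).
  assert (Hs8 : s ^ 8 = INR (length l) / N)
    by (apply rt8_pow, Rlt_le, Rdiv_lt_0_compat; lra).
  assert (Hs8p : 0 < s ^ 8) by (rewrite Hs8; apply Rdiv_lt_0_compat; lra).
  assert (Hs : 0 < s).
  { destruct (rt8_nonneg (INR (length l) / N)) as [H|H]; [exact H|].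
    fold s in H. rewrite <- H in Hs8p. simpl in Hs8p. lra. }
  assert (Hs1 : s <= 1).
  { apply (pow_le_reg 8); [lia|lra|]. rewrite Hs8, pow1. apply Rle_div_l; [lra|].
    destruct Hsp as [H _]; lra. }
  assert (HE : 0 < sqrt (S * b)) by (apply sqrt_lt_R0; nra).
  set (E := sqrt (S * b)) in *.
  pose proof (disc_sqr M0 S b HM) as HK. pose proof (disc_pos M0 S b HM HS Hb) as HKp.
  fold E in HK.
  assert (Hs2 : 0 < s ^ 2) by (apply pow_lt; lra).
  assert (Hs4 : 0 < s ^ 4) by (apply pow_lt; lra).
  apply (partial_coloring l w m (E * s ^ 4) (disc M0 S b * s) (16 * M0 / s ^ 8)).
  - exact Hl.
  - nra.
  - nra.
  - apply Rdiv_lt_0_compat; lra.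
  - rewrite Rpow_mult_distr, HK.
    assert (s ^ 4 <= s ^ 2).
    { replace (s ^ 4) with (s ^ 2 * s ^ 2) by ring.
      assert (s ^ 2 <= 1) by nra. nra. }
    assert (E <= 32 * M0 * E) by nra.
    nra.
  - intros t Ht. now apply spread_energy with m.
  - replace ((disc M0 S b * s) ^ 2 / (8 * (E * s ^ 4))) with (16 * M0 / s ^ 2)
      by (rewrite Rpow_mult_distr, HK; field; lra).
    replace (INR (length l)) with (s ^ 8 * N) by (rewrite Hs8; field; lra).
    apply Rle_trans with (M0 * N * (2 * (16 * M0 / s ^ 8) * exp (- (16 * M0 / s ^ 2))
        + 2 / (16 * M0 / s ^ 8))).
    + apply Rmult_le_compat_r; [|exact Hm].
      pose proof (exp_pos (- (16 * M0 / s ^ 2))).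
      assert (0 < 16 * M0 / s ^ 8) by (apply Rdiv_lt_0_compat; lra).
      assert (0 < 2 / (16 * M0 / s ^ 8)) by (apply Rdiv_lt_0_compat; lra). nra.
    + replace (M0 * N * (2 * (16 * M0 / s ^ 8) * exp (- (16 * M0 / s ^ 2))
        + 2 / (16 * M0 / s ^ 8)))
       with (N / 8 * (256 * M0 ^ 2 * exp (- (16 * M0 / s ^ 2)) / s ^ 8) + N / 8 * s ^ 8)
       by (field; lra).
      assert (256 * M0 ^ 2 * exp (- (16 * M0 / s ^ 2)) / s ^ 8 <= s ^ 8).
      { apply Rle_div_l; [lra|]. rewrite <- pow_add. now apply coloring_entropy_bound. }
      nra.
Qed.

(** Each partial colouring shrinks the uncoloured part by 9/10, hence the width
    of the next one by [99 / 100 >= (9 / 10) ^ (1 / 8)]; the constant 100 is the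
    sum of that geometric series. *)
Lemma balanced_splitting {U} (w : nat -> U -> R) m M0 N S b :
  1 <= M0 -> 0 < N -> 0 < S -> 0 < b -> INR m <= M0 * N ->
  forall l, spread w m N S b l ->
  exists P Q, Permutation l (P ++ Q) /\
    forall t, (t < m)%nat ->
      Rabs (lsum (w t) P - lsum (w t) Q) <= 100 * disc M0 S b * rt8 (INR (length l) / N).
Proof.
  intros HM HN HS Hb Hm l.
  assert (HKp := disc_pos M0 S b HM HS Hb).
  induction l as [l IH] using (well_founded_induction
    (Wf_nat.well_founded_ltof _ (@length U))).
  intros Hsp. destruct (Nat.eq_dec (length l) 0) as [E0|E0].
  { exists [], []. destruct l; [|discriminate]. split; [constructor|].
    intros t _. simpl. rewrite Rminus_diag, Rabs_R0.
    apply Rmult_le_pos; [lra | apply rt8_nonneg]. }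
  destruct (spread_partial_coloring l w m M0 N S b HM HN HS Hb Hm Hsp ltac:(lia))
    as [P [Q [W [Hp [Hc HD]]]]].
  assert (Hlen := Permutation_length Hp). rewrite !length_app in Hlen.
  assert (HpW : Permutation l (W ++ P ++ Q)).
  { rewrite Hp, app_assoc. apply Permutation_app_comm. }
  destruct (IH W) as [P' [Q' [Hp' HD']]].
  { unfold ltof. lia. }
  { exact (spread_sub _ _ _ _ _ _ _ _ HpW Hsp). }
  exists (P ++ P'), (Q ++ Q'). split.
  - rewrite Hp, Hp', !app_assoc. apply Permutation_app_tail.
    rewrite <- !app_assoc. apply Permutation_app_head, Permutation_app_comm.
  - intros t Ht. specialize (HD t Ht). specialize (HD' t Ht).
    assert (Hr : rt8 (INR (length W) / N) <= 99 / 100 * rt8 (INR (length l) / N)).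
    { assert (Hi : 0 < / N) by (apply Rinv_0_lt_compat, HN).
      apply rt8_scale.
      - lra.
      - apply Rmult_le_pos; [apply pos_INR | lra].
      - apply Rmult_le_pos; [apply pos_INR | lra].
      - unfold Rdiv at 1 3. rewrite <- Rmult_assoc. apply Rmult_le_compat_r; [lra|].
        assert (10 * INR (length W) <= 9 * INR (length l)).
        { pose proof (le_INR (10 * length W) (9 * length l) ltac:(lia)) as H10.
          rewrite !mult_INR, (INR_IZR_INZ 10), (INR_IZR_INZ 9) in H10. exact H10. }
        pose proof (pos_INR (length l)). simpl pow. lra. }
    rewrite !lsum_app.
    replace (_ - _) with ((lsum (w t) P - lsum (w t) Q) + (lsum (w t) P' - lsum (w t) Q')) by ring.
    eapply Rle_trans; [apply Rabs_triang|].
    pose proof (rt8_nonneg (INR (length W) / N)). nra.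
Qed.

(** The binary digits of the weights are removed from the last one on.  Moving
    odd weights up on one part of a balanced splitting and down on the other
    changes the weighted sum by [2 ^ (- J)] times the discrepancy of the
    splitting, and these errors sum to a geometric series. *)
Lemma dyadic_rounding {U} (w : nat -> U -> R) m M0 N S b J :
  1 <= M0 -> 0 < N -> 0 < S -> 0 < b -> INR m <= M0 * N ->
  forall T : list (U * nat), spread w m N S b (map fst T) ->
  (forall ua, In ua T -> (snd ua <= 2 ^ J)%nat) ->
  exists P Q, Permutation (map fst T) (P ++ Q) /\
    forall t, (t < m)%nat ->
      Rabs (lsum (w t) P - lsum (fun ua => INR (snd ua) / 2 ^ J * w t (fst ua)) T)
      <= 100 * disc M0 S b * (1 - / 2 ^ J).
Proof.
  intros HM HN HS Hb Hm. assert (HKp := disc_pos M0 S b HM HS Hb).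
  induction J as [|J IH]; intros T Hsp Ha.
  - set (p := fun ua : U * nat => Nat.eqb (snd ua) 1).
    exists (map fst (filter p T)), (map fst (filter (fun ua => negb (p ua)) T)). split.
    + rewrite <- map_app. apply Permutation_map, filter_partition.
    + intros t _. rewrite (lsum_perm _ _ _ (filter_partition p T)), lsum_app, lsum_map.
      rewrite (lsum_ext (fun ua => INR (snd ua) / 2 ^ 0 * w t (fst ua))
        (fun ua => w t (fst ua)) (filter p T)).
      2:{ intros ua Hu. apply filter_In in Hu. destruct Hu as [_ Hu].
          apply Nat.eqb_eq in Hu. rewrite Hu. simpl. field. }
      rewrite (lsum_ext (fun ua => INR (snd ua) / 2 ^ 0 * w t (fst ua))
        (fun _ => 0) (filter (fun x => negb (p x)) T)).
      2:{ intros ua Hu. apply filter_In in Hu. destruct Hu as [Hin Hu].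
          apply Bool.negb_true_iff, Nat.eqb_neq in Hu. specialize (Ha ua Hin). simpl in Ha.
          replace (snd ua) with 0%nat by lia. simpl. field. }
      rewrite lsum_const. rewrite Rmult_0_r, Rplus_0_r, Rminus_diag, Rabs_R0.
      simpl. lra.
  - set (p := fun ua : U * nat => Nat.odd (snd ua)).
    pose proof (filter_partition p T) as HT.
    set (O := filter p T) in *. set (E := filter (fun x => negb (p x)) T) in *.
    assert (HspO : spread w m N S b (map fst O)).
    { apply (spread_sub _ _ _ _ _ (map fst T) _ (map fst E)); [|exact Hsp].
      rewrite <- map_app. now apply Permutation_map. }
    destruct (balanced_splitting w m M0 N S b HM HN HS Hb Hm _ HspO) as [P [Q [HP HD]]].
    apply Permutation_sym, Permutation_map_inv in HP. destruct HP as [O' [EO HO]].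
    symmetry in EO. apply map_eq_app in EO. destruct EO as [OP [OQ [-> [EP EQ]]]].
    subst P Q.
    set (up := fun ua : U * nat => (fst ua, Nat.div2 (Datatypes.S (snd ua)))).
    set (dn := fun ua : U * nat => (fst ua, Nat.div2 (snd ua))).
    set (T' := map up OP ++ map dn OQ ++ map dn E).
    assert (HTT : Permutation (map fst T) (map fst T')).
    { unfold T'. rewrite !map_app, !map_map. cbn [fst up dn].
      rewrite HT, HO, !map_app, <- app_assoc. reflexivity. }
    assert (HOin : forall ua, In ua (OP ++ OQ) -> In ua T /\ Nat.odd (snd ua) = true).
    { intros ua Hu. apply (Permutation_in ua (Permutation_sym HO)) in Hu.
      now apply filter_In in Hu. }
    assert (Hodd : forall ua, In ua (OP ++ OQ) ->
      exists c, snd ua = (2 * c + 1)%nat /\ (2 * c + 1 <= 2 * 2 ^ J)%nat).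
    { intros ua Hu. apply HOin in Hu. destruct Hu as [Hin Ho].
      apply Nat.odd_spec in Ho. destruct Ho as [c Hc]. exists c. split; [exact Hc|].
      specialize (Ha ua Hin). simpl in Ha. lia. }
    assert (Heven : forall ua, In ua E ->
      exists c, snd ua = (2 * c)%nat /\ (2 * c <= 2 * 2 ^ J)%nat).
    { intros ua Hu. apply filter_In in Hu. destruct Hu as [Hin Ho].
      unfold p in Ho. rewrite Nat.negb_odd in Ho. apply Nat.even_spec in Ho.
      destruct Ho as [c Hc]. exists c. split; [exact Hc|].
      specialize (Ha ua Hin). simpl in Ha. lia. }
    assert (Eup : forall c, Nat.div2 (Datatypes.S (2 * c + 1)) = Datatypes.S c).
    { intros c. replace (Datatypes.S (2 * c + 1)) with (2 * Datatypes.S c)%nat by lia.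
      apply Nat.div2_double. }
    assert (Edn : forall c, Nat.div2 (2 * c + 1) = c).
    { intros c. replace (2 * c + 1)%nat with (Datatypes.S (2 * c)) by lia.
      apply Nat.div2_succ_double. }
    destruct (IH T') as [P [Q [HPQ Hr]]].
    { apply (spread_sub _ _ _ _ _ (map fst T) _ []); [now rewrite app_nil_r | exact Hsp]. }
    { intros ua Hu. unfold T' in Hu. rewrite !in_app_iff, !in_map_iff in Hu.
      destruct Hu as [[x [<- Hx]]|[[x [<- Hx]]|[x [<- Hx]]]]; cbn [snd up dn].
      - destruct (Hodd x ltac:(apply in_or_app; now left)) as [c [-> Hc]]. rewrite Eup. lia.
      - destruct (Hodd x ltac:(apply in_or_app; now right)) as [c [-> Hc]]. rewrite Edn. lia.
      - destruct (Heven x Hx) as [c [-> Hc]]. rewrite Nat.div2_double. lia. }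
    exists P, Q. split; [now rewrite HTT|].
    intros t Ht. specialize (Hr t Ht). specialize (HD t Ht).
    assert (H2 : 0 < 2 ^ J) by (apply pow_lt; lra).
    assert (Hdiff : lsum (fun ua => INR (snd ua) / 2 ^ J * w t (fst ua)) T'
      - lsum (fun ua => INR (snd ua) / 2 ^ Datatypes.S J * w t (fst ua)) T
      = / 2 ^ Datatypes.S J * (lsum (w t) (map fst OP) - lsum (w t) (map fst OQ))).
    { rewrite (lsum_perm _ T _ HT), lsum_app, (lsum_perm _ O _ HO), lsum_app.
      unfold T'. rewrite !lsum_app, !lsum_map. cbn [fst snd up dn].
      rewrite (lsum_ext (fun u => INR (Nat.div2 (Datatypes.S (snd u))) / 2 ^ J * w t (fst u))
        (fun u => INR (snd u) / 2 ^ Datatypes.S J * w t (fst u)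
           + / 2 ^ Datatypes.S J * w t (fst u)) OP).
      2:{ intros x Hx. destruct (Hodd x ltac:(apply in_or_app; now left)) as [c [-> Hc]].
          rewrite Eup, S_INR, plus_INR, mult_INR. simpl. field. lra. }
      rewrite (lsum_ext (fun u => INR (Nat.div2 (snd u)) / 2 ^ J * w t (fst u))
        (fun u => INR (snd u) / 2 ^ Datatypes.S J * w t (fst u)
           + (- / 2 ^ Datatypes.S J) * w t (fst u)) OQ).
      2:{ intros x Hx. destruct (Hodd x ltac:(apply in_or_app; now right)) as [c [-> Hc]].
          rewrite Edn, plus_INR, mult_INR. simpl. field. lra. }
      rewrite (lsum_ext (fun u => INR (Nat.div2 (snd u)) / 2 ^ J * w t (fst u))
        (fun u => INR (snd u) / 2 ^ Datatypes.S J * w t (fst u)) E).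
      2:{ intros x Hx. destruct (Heven x Hx) as [c [-> Hc]].
          rewrite Nat.div2_double, mult_INR. simpl. field. lra. }
      rewrite !lsum_plus, !lsum_scal. ring. }
    assert (Hrt : rt8 (INR (length (map fst O)) / N) <= 1).
    { apply (pow_le_reg 8); [lia|lra|]. destruct HspO as [HO1 _].
      rewrite rt8_pow, pow1; [apply Rle_div_l; lra|].
      apply Rmult_le_pos; [apply pos_INR | apply Rlt_le, Rinv_0_lt_compat, HN]. }
    replace (_ - _) with
      ((lsum (w t) P - lsum (fun ua => INR (snd ua) / 2 ^ J * w t (fst ua)) T') +
       / 2 ^ Datatypes.S J * (lsum (w t) (map fst OP) - lsum (w t) (map fst OQ)))
      by (rewrite <- Hdiff; ring).
    eapply Rle_trans; [apply Rabs_triang|].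
    assert (H3 : 0 < / 2 ^ Datatypes.S J) by (apply Rinv_0_lt_compat, pow_lt; lra).
    rewrite Rabs_mult, (Rabs_right (/ _)) by lra.
    assert (H4 : / 2 ^ J = 2 * / 2 ^ Datatypes.S J) by (simpl; field; lra).
    rewrite H4 in Hr.
    set (h := / 2 ^ Datatypes.S J) in *.
    assert (HD1 : Rabs (lsum (w t) (map fst OP) - lsum (w t) (map fst OQ)) <= 100 * disc M0 S b).
    { eapply Rle_trans; [exact HD|]. nra. }
    apply (Rmult_le_compat_l h) in HD1; lra.
Qed.

(** Giving opposite signs to the members of each pair makes the two halves
    equally long. *)
Lemma pairing {U} (l : list U) : exists (l2 : list (U * U)) (r : list U),
  Permutation l (map fst l2 ++ map snd l2 ++ r) /\ (length r <= 1)%nat.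
Proof.
  induction l as [|u l [l2 [r [Hp Hr]]]].
  - exists [], []. split; [constructor | simpl; lia].
  - destruct r as [|v r].
    + exists l2, [u]. split; [|simpl; lia]. rewrite app_nil_r in Hp.
      rewrite app_assoc. rewrite <- Hp. apply Permutation_cons_append.
    + destruct r; [|simpl in Hr; lia].
      exists ((u, v) :: l2), []. split; [|simpl; lia]. cbn [map fst snd].
      rewrite app_nil_r. simpl. constructor. rewrite Hp.
      apply Permutation_app_head. apply Permutation_sym, Permutation_cons_append.
Qed.

(** Each half of [l] has half the sum of [l], up to half the discrepancy of a
    splitting of the differences of pairs.  A prefix of the concatenation is a
    prefix of the first ordered half, or the whole first half followed by a
    prefix of the second; in both cases the bound for the halves, which is
    smaller by a factor [24 / 25 >= (2 / 3) ^ (1 / 8)], leaves enough room for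
    the discrepancy [201 disc * s] since [5025 = 25 * 201]. *)
Lemma small_prefix_ordering {U} (w : nat -> U -> R) m M0 N S b :
  1 <= M0 -> 0 < N -> 0 < S -> 0 < b -> INR m <= M0 * N ->
  forall l tau, spread w m N S b l ->
  (forall t, (t < m)%nat -> Rabs (lsum (w t) l) <= tau) ->
  exists l', Permutation l l' /\ forall i t, (t < m)%nat ->
    Rabs (lsum (w t) (firstn i l')) <= tau + 5025 * disc M0 S b * rt8 (INR (length l) / N).
Proof.
  intros HM HN HS Hb Hm l.
  assert (HKp := disc_pos M0 S b HM HS Hb).
  induction l as [l IH] using (well_founded_induction
    (Wf_nat.well_founded_ltof _ (@length U))).
  intros tau Hsp Htau.
  assert (Hi : 0 < / N) by (apply Rinv_0_lt_compat, HN).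
  assert (Hrn : forall k : list U, 0 <= INR (length k) / N)
    by (intros; apply Rmult_le_pos; [apply pos_INR | lra]).
  destruct (le_lt_dec (length l) 1) as [Hs|Hs].
  { exists l. split; [reflexivity|]. intros i t Ht.
    pose proof (Htau t Ht) as H1. pose proof (Rabs_pos (lsum (w t) l)) as H2.
    pose proof (rt8_nonneg (INR (length l) / N)) as H3.
    assert (0 <= 5025 * disc M0 S b * rt8 (INR (length l) / N)) by nra.
    destruct l as [|u [|]]; [|destruct i|]; simpl in *; rewrite ?firstn_nil; try lia; simpl;
      rewrite ?Rabs_R0; lra. }
  destruct (pairing l) as [l2 [r [Hp Hr]]].
  assert (Hlen := Permutation_length Hp). rewrite !length_app, !length_map in Hlen.
  set (w2 := fun t (uv : U * U) => w t (fst uv) - w t (snd uv)).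
  set (s := rt8 (INR (length l) / N)).
  assert (Hs0 : 0 <= s) by apply rt8_nonneg.
  assert (Hp12 : Permutation l ((map fst l2 ++ map snd l2) ++ r)) by (now rewrite <- app_assoc).
  pose proof (spread_sub _ _ _ _ _ _ _ _ Hp12 Hsp) as Hsp12.
  assert (Hsp2 : spread w2 m N (2 * S) (4 * b) l2).
  { destruct Hsp12 as [G1 [G2 G3]]. split; [|split].
    - rewrite length_app, !length_map, plus_INR in G1. pose proof (pos_INR (length l2)). lra.
    - intros t Ht. specialize (G2 t Ht). rewrite lsum_app, !lsum_map in G2.
      rewrite <- lsum_plus in G2.
      apply Rle_trans with (lsum (fun u => 2 * (w t (fst u) ^ 2 + w t (snd u) ^ 2)) l2).
      + apply lsum_le. intros u _. unfold w2.
        pose proof (pow2_ge_0 (w t (fst u) + w t (snd u))). nra.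
      + rewrite lsum_scal. lra.
    - intros t u Ht Hu. unfold w2.
      assert (B1 := G3 t (fst u) Ht ltac:(apply in_or_app; left; now apply in_map)).
      assert (B2 := G3 t (snd u) Ht ltac:(apply in_or_app; right; now apply in_map)).
      replace (4 * b / N) with (4 * (b / N)) by (field; lra).
      pose proof (pow2_ge_0 (w t (fst u) + w t (snd u))). nra. }
  destruct (balanced_splitting w2 m M0 N (2 * S) (4 * b) HM HN ltac:(lra) ltac:(lra) Hm l2 Hsp2)
    as [P [Q [HPQ HD]]].
  assert (Hlen2 := Permutation_length HPQ). rewrite length_app in Hlen2.
  assert (Hdisc : disc M0 (2 * S) (4 * b) <= 2 * disc M0 S b).
  { apply (pow_le_reg 2); [lia | lra |].
    rewrite Rpow_mult_distr, !disc_sqr by exact HM.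
    assert (sqrt (2 * S * (4 * b)) <= 4 * sqrt (S * b)).
    { replace (2 * S * (4 * b)) with (8 * (S * b)) by ring.
      rewrite sqrt_mult by nra.
      apply Rmult_le_compat_r; [apply sqrt_pos|].
      replace 4 with (sqrt (4 * 4)) by (apply sqrt_square; lra).
      apply sqrt_le_1_alt; lra. }
    nra. }
  set (T1 := map fst P ++ map snd Q ++ r). set (T2 := map snd P ++ map fst Q).
  assert (HT : Permutation l (T1 ++ T2)).
  { rewrite Hp, HPQ, !map_app. unfold T1, T2. rewrite <- !app_assoc.
    apply Permutation_app_head.
    rewrite (Permutation_app_comm (map fst Q) (map snd P ++ map snd Q ++ r)), <- !app_assoc.
    rewrite (Permutation_app_comm (map snd P) (map snd Q ++ r ++ map fst Q)), <- !app_assoc.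
    do 2 apply Permutation_app_head. apply Permutation_app_comm. }
  assert (HT' : Permutation l (T2 ++ T1)) by (rewrite HT; apply Permutation_app_comm).
  assert (L1 : (3 * length T1 <= 2 * length l)%nat)
    by (unfold T1; rewrite !length_app, !length_map; lia).
  assert (L2 : (3 * length T2 <= 2 * length l)%nat)
    by (unfold T2; rewrite !length_app, !length_map; lia).
  assert (Hshrink : forall k : list U, (3 * length k <= 2 * length l)%nat ->
    rt8 (INR (length k) / N) <= 24 / 25 * s).
  { intros k Hk. apply rt8_scale; auto; [lra|].
    unfold Rdiv at 1 3. rewrite <- Rmult_assoc. apply Rmult_le_compat_r; [lra|].
    apply le_INR in Hk. rewrite !mult_INR in Hk. simpl (INR 3) in Hk. simpl (INR 2) in Hk.
    pose proof (pos_INR (length l)). simpl pow. lra. }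
  set (g := 201 * disc M0 S b * s).
  assert (Hgap : forall t, (t < m)%nat -> Rabs (lsum (w t) T1 - lsum (w t) T2) <= g).
  { intros t Ht. specialize (HD t Ht).
    assert (E : lsum (w t) T1 - lsum (w t) T2 = (lsum (w2 t) P - lsum (w2 t) Q) + lsum (w t) r).
    { unfold T1, T2, w2. rewrite !lsum_app, !lsum_map.
      rewrite !lsum_minus. ring. }
    (* An unpaired last element is bounded through the energy of [l]. *)
    assert (Hlast : Rabs (lsum (w t) r) <= disc M0 S b * s).
    { apply (pow_le_reg 2); [lia | nra |]. rewrite pow2_abs, Rpow_mult_distr, disc_sqr by exact HM.
      assert (Hr2 : lsum (w t) r ^ 2 <= lsum (fun u => w t u ^ 2) l).
      { rewrite (lsum_perm _ _ _ Hp), !lsum_app.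
        assert (Pos : forall k, 0 <= lsum (fun u => w t u ^ 2) k)
          by (intros; apply lsum_nonneg; intros; apply pow2_ge_0).
        pose proof (Pos (map fst l2)). pose proof (Pos (map snd l2)).
        destruct r as [|u [|]]; simpl in *; try lia; lra. }
      pose proof (spread_energy w m N S b l t HN HS Hb Hsp Ht) as He. fold s in He.
      assert (s <= 1).
      { apply (pow_le_reg 8); [lia|lra|]. unfold s. rewrite rt8_pow, pow1 by auto.
        apply Rle_div_l; [lra|]. destruct Hsp; lra. }
      assert (s ^ 4 <= s ^ 2).
      { replace (s ^ 4) with (s ^ 2 * s ^ 2) by ring.
        pose proof (pow2_ge_0 s). assert (s ^ 2 <= 1) by nra. nra. }
      pose proof (sqrt_pos (S * b)). pose proof (pow2_ge_0 s).
      apply Rle_trans with (sqrt (S * b) * s ^ 2); [nra|].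
      apply Rmult_le_compat_r; [lra|]. nra. }
    assert (rt8 (INR (length l2) / N) <= 1 * s).
    { apply rt8_scale; auto; [lra | apply Rmult_le_pos; [apply pos_INR | lra] |].
      rewrite pow1, Rmult_1_l. apply Rmult_le_compat_r; [lra | apply le_INR; lia]. }
    rewrite E. eapply Rle_trans; [apply Rabs_triang|]. unfold g.
    pose proof (rt8_nonneg (INR (length l2) / N)).
    assert (100 * disc M0 (2 * S) (4 * b) * rt8 (INR (length l2) / N) <= 200 * disc M0 S b * s).
    { apply Rle_trans with (100 * (2 * disc M0 S b) * rt8 (INR (length l2) / N)).
      - apply Rmult_le_compat_r; lra.
      - apply Rle_trans with (100 * (2 * disc M0 S b) * s); [|lra].
        apply Rmult_le_compat_l; lra. }
    lra. }
  assert (Hsum : forall t, lsum (w t) l = lsum (w t) T1 + lsum (w t) T2)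
    by (intros t; rewrite (lsum_perm _ _ _ HT); apply lsum_app).
  destruct (IH T1 ltac:(unfold ltof; lia) ((tau + g) / 2)) as [l1' [Hl1 Hb1]].
  { exact (spread_sub _ _ _ _ _ _ _ _ HT Hsp). }
  { intros t Ht. specialize (Hgap t Ht). specialize (Htau t Ht). rewrite Hsum in Htau.
    apply Rabs_le_between in Hgap, Htau. apply Rabs_le. lra. }
  destruct (IH T2 ltac:(unfold ltof; lia) ((tau + g) / 2)) as [l2' [Hl2 Hb2]].
  { exact (spread_sub _ _ _ _ _ _ _ _ HT' Hsp). }
  { intros t Ht. specialize (Hgap t Ht). specialize (Htau t Ht). rewrite Hsum in Htau.
    apply Rabs_le_between in Hgap, Htau. apply Rabs_le. lra. }
  exists (l1' ++ l2'). split; [now rewrite HT, Hl1, Hl2|].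
  intros i t Ht. fold s.
  assert (Hstep : forall k : list U, (3 * length k <= 2 * length l)%nat ->
    5025 * disc M0 S b * rt8 (INR (length k) / N) <= 4824 * disc M0 S b * s).
  { intros k Hk. specialize (Hshrink k Hk). nra. }
  pose proof (Hstep T1 L1) as S1. pose proof (Hstep T2 L2) as S2.
  assert (Hg : g = 201 * disc M0 S b * s) by reflexivity.
  assert (0 <= disc M0 S b * s) by nra.
  assert (0 <= tau) by (eapply Rle_trans; [apply Rabs_pos | exact (Htau t Ht)]).
  rewrite firstn_app. destruct (le_lt_dec i (length l1')) as [Hil|Hil].
  - replace (i - length l1')%nat with 0%nat by lia. rewrite firstn_O, app_nil_r.
    specialize (Hb1 i t Ht). lra.
  - rewrite firstn_all2 by lia. rewrite lsum_app, <- (lsum_perm _ _ _ Hl1).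
    specialize (Hb2 (i - length l1')%nat t Ht).
    assert (Rabs (lsum (w t) T1) <= (tau + g) / 2).
    { specialize (Hgap t Ht). specialize (Htau t Ht). rewrite Hsum in Htau.
      apply Rabs_le_between in Hgap, Htau. apply Rabs_le. lra. }
    eapply Rle_trans; [apply Rabs_triang|]. lra.
Qed.

(** * The Fejer kernel *)

Lemma cos_mul_cos a b : cos a * cos b = / 2 * (cos (a + b) + cos (a - b)).
Proof. rewrite cos_plus, cos_minus. field. Qed.

(** The term [k = n] has coefficient 0; including it avoids a predecessor. *)
Definition fejer (n : nat) (y : R) : R :=
  1 + lsum (fun k => (1 - INR k / INR n) * (2 * cos (INR k * y))) (seq 1 n).

Lemma dirichlet_closed n y :
  (1 - cos y) * (1 + lsum (fun k => 2 * cos (INR k * y)) (seq 1 n))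
  = cos (INR n * y) - cos (INR (S n) * y).
Proof.
  induction n as [|n IH].
  - simpl. rewrite Rmult_0_l, cos_0, Rmult_1_l. ring.
  - rewrite seq_S, lsum_app. cbn [lsum]. rewrite Rplus_0_r, <- Rplus_assoc, Rmult_plus_distr_l, IH.
    replace (1 + n)%nat with (S n) by lia.
    pose proof (cos_mul_cos (INR (S n) * y) y) as H.
    replace (INR (S n) * y + y) with (INR (S (S n)) * y) in H by (rewrite (S_INR (S n)); ring).
    replace (INR (S n) * y - y) with (INR n * y) in H by (rewrite (S_INR n); ring).
    lra.
Qed.

(** The Fejer kernel is the average of Dirichlet kernels, whose multiples by
    [1 - cos y] telescope. *)
Lemma fejer_closed n y : (1 <= n)%nat ->
  (1 - cos y) * (INR n * fejer n y) = 1 - cos (INR n * y).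
Proof.
  intros Hn.
  assert (E : INR n * fejer n y
    = INR n + lsum (fun k => (INR n - INR k) * (2 * cos (INR k * y))) (seq 1 n)).
  { assert (0 < INR n) by (apply lt_0_INR; lia).
    unfold fejer. rewrite Rmult_plus_distr_l, Rmult_1_r, <- lsum_scal. f_equal.
    apply lsum_ext. intros k _. field. lra. }
  rewrite E. clear E Hn. induction n as [|n IH].
  - simpl. rewrite Rmult_0_l, cos_0. ring.
  - replace (INR (S n) + lsum _ _) with
      ((INR n + lsum (fun k => (INR n - INR k) * (2 * cos (INR k * y))) (seq 1 n))
       + (1 + lsum (fun k => 2 * cos (INR k * y)) (seq 1 n))).
    + rewrite Rmult_plus_distr_l, IH, dirichlet_closed. ring.
    + rewrite seq_S, lsum_app. cbn [lsum]. replace (1 + n)%nat with (S n) by lia.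
      rewrite Rminus_diag.
      rewrite (lsum_ext (fun k => (INR (S n) - INR k) * _) (fun k =>
        (INR n - INR k) * (2 * cos (INR k * y)) + 2 * cos (INR k * y)))
        by (intros; rewrite S_INR; ring).
      rewrite lsum_plus, S_INR. ring.
Qed.

Lemma cos_mult_1 y k : cos y = 1 -> cos (INR k * y) = 1.
Proof.
  intros H. assert (Hs : sin y = 0).
  { pose proof (sin2_cos2 y) as E. unfold Rsqr in E. rewrite H in E. nra. }
  induction k as [|k IH]; [simpl; rewrite Rmult_0_l; apply cos_0|].
  rewrite S_INR, Rmult_plus_distr_r, Rmult_1_l, cos_plus, H, Hs, IH. ring.
Qed.

Lemma fejer_nonneg n y : (1 <= n)%nat -> 0 <= fejer n y.
Proof.
  intros Hn. assert (Hp : 0 < INR n) by (apply lt_0_INR; lia).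
  pose proof (COS_bound y). pose proof (COS_bound (INR n * y)).
  destruct (Req_dec (cos y) 1) as [E|E].
  - unfold fejer. apply Rplus_le_le_0_compat; [lra|]. apply lsum_nonneg.
    intros k Hk. apply in_seq in Hk. rewrite cos_mult_1 by exact E.
    assert (INR k <= INR n) by (apply le_INR; lia).
    assert (INR k / INR n <= 1) by (apply Rle_div_l; lra). lra.
  - pose proof (fejer_closed n y Hn). apply Rnot_lt_le. intros Hlt.
    assert (0 < 1 - cos y) by lra. assert (INR n * fejer n y < 0) by nra. nra.
Qed.

(** This pointwise form of the concentration at 0 replaces any estimate of
    integrals of the kernel away from 0. *)
Lemma fejer_concentrated n y : (1 <= n)%nat -> (1 - cos y) * fejer n y <= 2 / INR n.
Proof.
  intros Hn. assert (Hp : 0 < INR n) by (apply lt_0_INR; lia).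
  pose proof (fejer_closed n y Hn). pose proof (COS_bound (INR n * y)).
  apply (Rmult_le_reg_r (INR n)); [exact Hp|].
  replace (2 / INR n * INR n) with 2 by (field; lra). lra.
Qed.

(** * Trigonometric polynomials on a grid *)

Definition grid_pt (m j : nat) : R := 2 * PI * INR j / INR m.

Definition grid_mean (m : nat) (h : R -> R) : R :=
  / INR m * lsum (fun j => h (grid_pt m j)) (seq 0 m).

Lemma cos_progression_sum h c n :
  2 * sin (h / 2) * lsum (fun j => cos (INR j * h + c)) (seq 0 n)
  = sin (INR n * h + c - h / 2) - sin (c - h / 2).
Proof.
  induction n as [|n IH].
  - simpl. rewrite Rmult_0_l, Rplus_0_l. ring.
  - rewrite seq_S, lsum_app. cbn [lsum]. rewrite Rplus_0_r, Rmult_plus_distr_l, IH, Nat.add_0_l.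
    replace (INR (S n) * h + c - h / 2) with ((INR n * h + c) + h / 2) by (rewrite S_INR; field).
    rewrite (sin_plus (INR n * h + c)), (sin_minus (INR n * h + c)). ring.
Qed.

Lemma grid_mean_cos_nat m l c : (0 < l < m)%nat ->
  grid_mean m (fun u => cos (INR l * u + c)) = 0.
Proof.
  intros Hl. unfold grid_mean. apply Rmult_eq_0_compat_l.
  assert (Hm : 0 < INR m) by (apply lt_0_INR; lia).
  assert (Hl0 : 0 < INR l) by (apply lt_0_INR; lia).
  assert (Hlm : INR l < INR m) by (apply lt_INR; lia).
  pose proof PI_RGT_0 as HPI.
  set (h := 2 * PI * INR l / INR m).
  rewrite (lsum_ext _ (fun j => cos (INR j * h + c)))
    by (intros; unfold h, grid_pt; f_equal; field; lra).
  pose proof (cos_progression_sum h c m) as H.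
  replace (INR m * h + c - h / 2) with (c - h / 2 + 2 * INR l * PI) in H
    by (unfold h; field; lra).
  rewrite sin_period, Rminus_diag in H.
  assert (0 < sin (h / 2)).
  { assert (E : h / 2 = PI * (INR l / INR m)) by (unfold h; field; lra).
    assert (0 < INR l / INR m) by (apply Rdiv_lt_0_compat; lra).
    assert (INR l / INR m < 1) by (apply Rlt_div_l; lra).
    apply sin_gt_0; rewrite E; nra. }
  apply Rmult_integral in H. destruct H; [lra | assumption].
Qed.

Lemma grid_mean_ext m h1 h2 : (forall u, h1 u = h2 u) -> grid_mean m h1 = grid_mean m h2.
Proof. intros H. unfold grid_mean. f_equal. apply lsum_ext. auto. Qed.

Lemma grid_mean_cos m (k l : nat) c : (k + l < m)%nat -> k <> l ->
  grid_mean m (fun u => cos ((INR k - INR l) * u + c)) = 0.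
Proof.
  intros Hm Hkl. destruct (le_lt_dec k l) as [H|H].
  - rewrite (grid_mean_ext m _ (fun u => cos (INR (l - k) * u + - c))).
    + apply grid_mean_cos_nat; lia.
    + intros u. rewrite <- cos_neg. f_equal. rewrite minus_INR by lia. ring.
  - rewrite (grid_mean_ext m _ (fun u => cos (INR (k - l) * u + c))).
    + apply grid_mean_cos_nat; lia.
    + intros u. rewrite minus_INR by lia. reflexivity.
Qed.

Lemma grid_mean_lsum {U} m (h : U -> R -> R) l :
  grid_mean m (fun u => lsum (fun k => h k u) l) = lsum (fun k => grid_mean m (h k)) l.
Proof. unfold grid_mean. rewrite lsum_exchange, <- lsum_scal. reflexivity. Qed.

Lemma grid_mean_plus m h1 h2 :
  grid_mean m (fun u => h1 u + h2 u) = grid_mean m h1 + grid_mean m h2.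
Proof. unfold grid_mean. rewrite lsum_plus. ring. Qed.

Lemma grid_mean_scal m c h : grid_mean m (fun u => c * h u) = c * grid_mean m h.
Proof. unfold grid_mean. rewrite lsum_scal. ring. Qed.

Lemma grid_mean_const m c : (0 < m)%nat -> grid_mean m (fun _ => c) = c.
Proof.
  intros Hm. unfold grid_mean. rewrite lsum_const, length_seq. field.
  apply not_0_INR; lia.
Qed.

Lemma grid_mean_fejer m n x : (n < m)%nat ->
  grid_mean m (fun u => fejer n (x - u)) = 1.
Proof.
  intros Hnm. unfold fejer. rewrite grid_mean_plus, grid_mean_const, grid_mean_lsum by lia.
  rewrite (lsum_ext _ (fun _ => 0)); [rewrite lsum_const; ring|].
  intros k Hk. apply in_seq in Hk. rewrite !grid_mean_scal.
  rewrite (grid_mean_ext m _ (fun u => cos (INR k * u + - (INR k * x)))).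
  - rewrite grid_mean_cos_nat by lia. ring.
  - intros u. rewrite <- cos_neg. f_equal. ring.
Qed.

(** The discrete orthogonality relations hold as long as the sum of two
    frequencies stays below the number [m] of grid points. *)
Lemma grid_mean_fejer_cos m n l x c : (1 <= l <= n)%nat -> (n + l < m)%nat ->
  grid_mean m (fun u => cos (INR l * u + c) * fejer n (x - u))
  = (1 - INR l / INR n) * cos (INR l * x + c).
Proof.
  intros Hl Hm.
  rewrite (grid_mean_ext m _ (fun u => cos (INR l * u + c) +
     lsum (fun k => (1 - INR k / INR n) *
       (cos (INR (l + k) * u + (c - INR k * x)) + cos ((INR l - INR k) * u + (c + INR k * x))))
       (seq 1 n))).
  2:{ intros u. unfold fejer. rewrite Rmult_plus_distr_l, Rmult_1_r, <- lsum_scal. f_equal.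
      apply lsum_ext. intros k _.
      pose proof (cos_mul_cos (INR l * u + c) (INR k * (x - u))) as E.
      replace (INR (l + k) * u + (c - INR k * x)) with (INR l * u + c - INR k * (x - u))
        by (rewrite plus_INR; ring).
      replace ((INR l - INR k) * u + (c + INR k * x)) with (INR l * u + c + INR k * (x - u)) by ring.
      transitivity ((1 - INR k / INR n) * (2 * (cos (INR l * u + c) * cos (INR k * (x - u)))));
        [ring|]. rewrite E. field.
      apply not_0_INR; lia. }
  rewrite grid_mean_plus, grid_mean_cos_nat, Rplus_0_l, grid_mean_lsum by lia.
  rewrite (lsum_single _ (seq 1 n) l).
  - rewrite grid_mean_scal, grid_mean_plus, grid_mean_cos_nat by lia.
    rewrite (grid_mean_ext m _ (fun _ => cos (INR l * x + c))), grid_mean_const by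
      (try lia; intros; f_equal; ring). ring.
  - apply seq_NoDup.
  - apply in_seq; lia.
  - intros k Hk Hne. apply in_seq in Hk.
    rewrite grid_mean_scal, grid_mean_plus, grid_mean_cos_nat, grid_mean_cos by lia. ring.
Qed.

Definition trig (p phi : nat -> R) (T : list nat) (x : R) : R :=
  lsum (fun k => p k * cos (INR k * x + phi k)) T.

(** The kernel [2 fejer (2 M) - fejer M] multiplies the frequencies up to [M] by
    1; its own degree is below [2 M], so a mean over [4 M] points is exact. *)
Lemma trig_reproducing p phi T M : (1 <= M)%nat ->
  (forall k, In k T -> (1 <= k <= M)%nat) -> forall x,
  trig p phi T x = grid_mean (4 * M) (fun u =>
    trig p phi T u * (2 * fejer (2 * M) (x - u) - fejer M (x - u))).
Proof.
  intros HM HT x. set (m := (4 * M)%nat) in *.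
  assert (Hmul : forall n, (M <= n <= 2 * M)%nat ->
    grid_mean m (fun u => trig p phi T u * fejer n (x - u))
    = lsum (fun k => (1 - INR k / INR n) * (p k * cos (INR k * x + phi k))) T).
  { intros n Hn.
    rewrite (grid_mean_ext m _ (fun u => lsum (fun k =>
      p k * (cos (INR k * u + phi k) * fejer n (x - u))) T)).
    2:{ intros u. unfold trig. rewrite Rmult_comm, <- lsum_scal. apply lsum_ext; intros; ring. }
    rewrite grid_mean_lsum. apply lsum_ext. intros k Hk. apply HT in Hk.
    rewrite grid_mean_scal, grid_mean_fejer_cos by lia. ring. }
  rewrite (grid_mean_ext m _ (fun u => 2 * (trig p phi T u * fejer (2 * M) (x - u))
      + -1 * (trig p phi T u * fejer M (x - u)))) by (intros; ring).
  rewrite grid_mean_plus, !grid_mean_scal, !Hmul, <- !lsum_scal, <- lsum_plus by lia.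
  unfold trig. apply lsum_ext. intros k _. rewrite mult_INR. simpl (INR 2). field.
  apply not_0_INR; lia.
Qed.

(** The reproducing kernel has mean absolute value at most [2 + 1 = 3].  The
    form with two polynomials serves for one frequency carrying different
    coefficients in them, as in rounding; one of them may be empty. *)
Lemma trig_diff_sup_le_grid p1 p2 phi T1 T2 M E : (1 <= M)%nat ->
  (forall k, In k (T1 ++ T2) -> (1 <= k <= M)%nat) ->
  (forall j, (j < 4 * M)%nat ->
    Rabs (trig p1 phi T1 (grid_pt (4 * M) j) - trig p2 phi T2 (grid_pt (4 * M) j)) <= E) ->
  forall x, Rabs (trig p1 phi T1 x - trig p2 phi T2 x) <= 3 * E.
Proof.
  intros HM HT HE x. set (m := (4 * M)%nat) in *.
  set (h := fun u => trig p1 phi T1 u - trig p2 phi T2 u).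
  change (Rabs (h x) <= 3 * E).
  assert (Hrep : h x = grid_mean m (fun u => h u * (2 * fejer (2 * M) (x - u) - fejer M (x - u)))).
  { rewrite (grid_mean_ext m _ (fun u =>
      trig p1 phi T1 u * (2 * fejer (2 * M) (x - u) - fejer M (x - u)) + -1 *
      (trig p2 phi T2 u * (2 * fejer (2 * M) (x - u) - fejer M (x - u)))))
      by (intros; unfold h; ring).
    rewrite grid_mean_plus, grid_mean_scal. unfold m.
    rewrite <- !trig_reproducing; [unfold h; ring | exact HM | | exact HM | ];
      intros k Hk; apply HT, in_or_app; tauto. }
  assert (HmR : 0 < / INR m) by (apply Rinv_0_lt_compat, lt_0_INR; lia).
  assert (Hbound : Rabs (h x)
    <= grid_mean m (fun u => E * (2 * fejer (2 * M) (x - u) + fejer M (x - u)))).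
  { rewrite Hrep. unfold grid_mean. rewrite Rabs_mult, (Rabs_right (/ INR m)) by lra.
    apply Rmult_le_compat_l; [lra|]. eapply Rle_trans; [apply lsum_Rabs|].
    apply lsum_le. intros j Hj. apply in_seq in Hj. rewrite Rabs_mult.
    pose proof (fejer_nonneg (2 * M) (x - grid_pt m j) ltac:(lia)).
    pose proof (fejer_nonneg M (x - grid_pt m j) ltac:(lia)).
    apply Rmult_le_compat; try apply Rabs_pos; [apply HE; lia|].
    apply Rabs_le. lra. }
  rewrite grid_mean_scal, grid_mean_plus, grid_mean_scal, !grid_mean_fejer in Hbound by lia.
  lra.
Qed.

(** * Fejer and de la Vallee Poussin means, Bessel inequality *)

Lemma is_RInt_lsum {U} (h : U -> R -> R) (I : U -> R) a b l :
  (forall k, In k l -> is_RInt (h k) a b (I k)) ->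
  is_RInt (fun u => lsum (fun k => h k u) l) a b (lsum I l).
Proof.
  induction l as [|k l IH]; intros H; cbn [lsum].
  - replace 0 with (scal (b - a) 0) at 1 by (unfold scal; simpl; unfold mult; simpl; ring).
    apply @is_RInt_const.
  - apply @is_RInt_plus; [apply H; now left | apply IH; intros; apply H; now right].
Qed.

Lemma is_RInt_lincomb (h1 h2 : R -> R) c1 c2 a b I1 I2 :
  is_RInt h1 a b I1 -> is_RInt h2 a b I2 ->
  is_RInt (fun u => c1 * h1 u + c2 * h2 u) a b (c1 * I1 + c2 * I2).
Proof. intros H1 H2. apply @is_RInt_plus; now apply @is_RInt_scal. Qed.

Lemma is_RInt_cst (c : R) : is_RInt (fun _ => c) 0 (2 * PI) (2 * PI * c).
Proof.
  replace (2 * PI * c) with (scal (2 * PI - 0) c)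
    by (unfold scal; simpl; unfold mult; simpl; ring).
  apply @is_RInt_const.
Qed.

Lemma is_RInt_cos_nat l c : (1 <= l)%nat ->
  is_RInt (fun u => cos (INR l * u + c)) 0 (2 * PI) 0.
Proof.
  intros Hl. assert (Hl0 : 0 < INR l) by (apply lt_0_INR; lia).
  set (F := fun u => / INR l * sin (INR l * u + c)).
  replace 0 with (minus (F (2 * PI)) (F 0)) at 2.
  - apply (is_RInt_derive (V := R_CompleteNormedModule) F).
    + intros u _. unfold F. auto_derive; [trivial|]. field. lra.
    + intros u _. apply (ex_derive_continuous (V := R_NormedModule)). auto_derive. trivial.
  - unfold minus, plus, opp; simpl. unfold F.
    replace (INR l * (2 * PI) + c) with (INR l * 0 + c + 2 * INR l * PI) by ring.
    rewrite sin_period. ring.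
Qed.

Lemma is_RInt_cos_diff (k l : nat) c : k <> l ->
  is_RInt (fun u => cos ((INR k - INR l) * u + c)) 0 (2 * PI) 0.
Proof.
  intros Hkl. destruct (le_lt_dec k l) as [H|H].
  - apply (is_RInt_ext (fun u => cos (INR (l - k) * u + - c))).
    + intros u _. rewrite <- cos_neg. f_equal. rewrite minus_INR by lia. ring.
    + apply is_RInt_cos_nat; lia.
  - apply (is_RInt_ext (fun u => cos (INR (k - l) * u + c))).
    + intros u _. rewrite minus_INR by lia. reflexivity.
    + apply is_RInt_cos_nat; lia.
Qed.

Lemma is_RInt_cos_cos (k l : nat) a b : (1 <= k)%nat -> (1 <= l)%nat -> k <> l ->
  is_RInt (fun u => cos (INR k * u + a) * cos (INR l * u + b)) 0 (2 * PI) 0.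
Proof.
  intros Hk Hl Hkl.
  replace 0 with (/ 2 * 0 + / 2 * 0) at 2 by ring.
  apply (is_RInt_ext (fun u => / 2 * cos (INR (k + l) * u + (a + b))
    + / 2 * cos ((INR k - INR l) * u + (a - b)))).
  - intros u _. rewrite cos_mul_cos, Rmult_plus_distr_l.
    f_equal; f_equal; f_equal; rewrite ?plus_INR; ring.
  - apply is_RInt_lincomb; [apply is_RInt_cos_nat; lia | now apply is_RInt_cos_diff].
Qed.

Lemma is_RInt_cos_sqr (k : nat) a : (1 <= k)%nat ->
  is_RInt (fun u => cos (INR k * u + a) * cos (INR k * u + a)) 0 (2 * PI) PI.
Proof.
  intros Hk. replace PI with (/ 2 * 0 + / 2 * (2 * PI * 1)) at 2 by field.
  apply (is_RInt_ext (fun u => / 2 * cos (INR (k + k) * u + (a + a)) + / 2 * 1)).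
  - intros u _. rewrite cos_mul_cos, Rminus_diag, cos_0, Rmult_plus_distr_l.
    f_equal; f_equal; f_equal; rewrite ?plus_INR; ring.
  - apply is_RInt_lincomb; [apply is_RInt_cos_nat; lia | apply is_RInt_cst].
Qed.

Lemma is_RInt_fejer n x : is_RInt (fun u => fejer n (x - u)) 0 (2 * PI) (2 * PI).
Proof.
  replace (2 * PI) with (2 * PI * 1 + lsum (fun _ => 0) (seq 1 n)) at 2
    by (rewrite lsum_const; ring).
  apply @is_RInt_plus; [apply is_RInt_cst|].
  apply is_RInt_lsum. intros k Hk. apply in_seq in Hk.
  replace 0 with (2 * (1 - INR k / INR n) * 0) at 2 by ring.
  apply (is_RInt_ext (fun u => 2 * (1 - INR k / INR n) * cos (INR k * u + - (INR k * x)))).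
  - intros u _.
    replace (INR k * (x - u)) with (- (INR k * u + - (INR k * x))) by ring.
    rewrite cos_neg. simpl. ring.
  - apply @is_RInt_scal. apply is_RInt_cos_nat; lia.
Qed.

(** That the term of frequency [k] in the Fourier series of [g] is
    [p k * cos (k x + phi k)], in the form of a convolution with [cos]. *)
Definition real_fourier (g : R -> R) (p phi : nat -> R) : Prop :=
  is_RInt g 0 (2 * PI) (2 * PI * p 0%nat) /\
  forall (k : nat) x, (1 <= k)%nat ->
    is_RInt (fun u => g u * cos (INR k * (x - u))) 0 (2 * PI)
      (PI * (p k * cos (INR k * x + phi k))).

Lemma is_RInt_fejer_conv g p phi n x : real_fourier g p phi ->
  is_RInt (fun u => g u * fejer n (x - u)) 0 (2 * PI)
    (2 * PI * (p 0%nat + trig (fun k => (1 - INR k / INR n) * p k) phi (seq 1 n) x)).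
Proof.
  intros [H0 Hk].
  rewrite Rmult_plus_distr_l.
  apply (is_RInt_ext (fun u => g u + lsum (fun k => 2 * (1 - INR k / INR n) *
     (g u * cos (INR k * (x - u)))) (seq 1 n))).
  - intros u _. unfold fejer. rewrite Rmult_plus_distr_l, Rmult_1_r, <- lsum_scal.
    apply f_equal. apply lsum_ext. intros; ring.
  - apply @is_RInt_plus; [exact H0|].
    unfold trig. rewrite <- lsum_scal. apply is_RInt_lsum.
    intros k Hin. apply in_seq in Hin.
    replace (2 * PI * ((1 - INR k / INR n) * p k * cos (INR k * x + phi k)))
      with (2 * (1 - INR k / INR n) * (PI * (p k * cos (INR k * x + phi k)))) by ring.
    apply @is_RInt_scal. apply Hk; lia.
Qed.

Lemma periodic_IZR (g : R -> R) : (forall x, g (x + 2 * PI) = g x) ->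
  forall z x, g (x + 2 * PI * IZR z) = g x.
Proof.
  intros Hper z.
  assert (G : forall n x, g (x + 2 * PI * INR n) = g x).
  { induction n as [|n IH]; intros x.
    - simpl. now rewrite Rmult_0_r, Rplus_0_r.
    - rewrite S_INR. replace (x + 2 * PI * (INR n + 1)) with (x + 2 * PI * INR n + 2 * PI) by ring.
      now rewrite Hper. }
  intros x. destruct (Z_le_dec 0 z) as [H|H].
  - replace z with (Z.of_nat (Z.to_nat z)) by lia. rewrite <- INR_IZR_INZ. apply G.
  - rewrite <- (G (Z.to_nat (- z)) (x + 2 * PI * IZR z)). f_equal.
    rewrite INR_IZR_INZ. replace (Z.of_nat (Z.to_nat (- z))) with (- z)%Z by lia.
    rewrite opp_IZR. ring.
Qed.

Lemma reduce_to_period x : exists z, 0 <= x + 2 * PI * IZR z <= 2 * PI.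
Proof.
  pose proof PI_RGT_0. destruct (base_Int_part (x / (2 * PI))) as [H1 H2].
  exists (- Int_part (x / (2 * PI)))%Z. rewrite opp_IZR.
  set (y := x / (2 * PI)) in *. replace x with (2 * PI * y) by (unfold y; field; lra).
  nra.
Qed.

(** Uniform continuity handles the points [u], [x] that are close modulo the
    period, boundedness the others, for which [1 - cos (u - x)] stays away
    from 0. *)
Lemma periodic_modulus g :
  (forall x, continuous g x) -> (forall x, g (x + 2 * PI) = g x) ->
  forall eps, 0 < eps -> exists C, 0 <= C /\
    forall x u, Rabs (g u - g x) <= eps + C * (1 - cos (u - x)).
Proof.
  intros Hc Hper eps Heps. pose proof PI_RGT_0 as HPI.
  assert (Hcp : forall x, continuity_pt g x)
    by (intros x; apply continuity_pt_filterlim; apply Hc).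
  destruct (Heine_cor2 (f := g) (a := - (2 * PI)) (b := 4 * PI) (fun x _ => Hcp x)
    (mkposreal eps Heps)) as [[d Hd] Hdelta]. simpl in Hdelta.
  destruct (continuity_ab_maj (fun x => Rabs (g x)) 0 (2 * PI) ltac:(lra)) as [xm [Hxm _]].
  { intros x _. apply (continuity_pt_comp g Rabs); [apply Hcp | apply Rcontinuity_abs]. }
  set (B := Rabs (g xm)) in *.
  (* Keeping the radius below [PI] makes [cos] decreasing up to it. *)
  set (e := Rmin d PI).
  assert (He : 0 < e) by (apply Rmin_glb_lt; assumption).
  assert (HePI : e <= PI) by apply Rmin_r. assert (Hed : e <= d) by apply Rmin_l.
  assert (Hce : cos e < 1).
  { rewrite <- cos_0. apply cos_decreasing_1; lra. }
  assert (HB : 0 <= B) by apply Rabs_pos.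
  assert (Core : forall x u, 0 <= x <= 2 * PI -> 0 <= u <= 2 * PI ->
    Rabs (g u - g x) <= eps + 2 * B / (1 - cos e) * (1 - cos (u - x))).
  { intros x u Hx Hu. set (C := 2 * B / (1 - cos e)).
    assert (HC : 0 <= C) by (apply Rmult_le_pos; [lra | apply Rlt_le, Rinv_0_lt_compat; lra]).
    pose proof (COS_bound (u - x)) as Hb.
    assert (0 <= C * (1 - cos (u - x))) by nra.
    assert (Hnear : forall v, - (2 * PI) <= v <= 4 * PI -> g v = g u -> Rabs (v - x) < e ->
       Rabs (g u - g x) <= eps + C * (1 - cos (u - x))).
    { intros v Hv Ev Hvx. rewrite <- Ev.
      pose proof (Hdelta v x Hv ltac:(lra) ltac:(lra)). lra. }
    assert (Hfar : cos (u - x) <= cos e -> Rabs (g u - g x) <= eps + C * (1 - cos (u - x))).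
    { intros Hcos. assert (2 * B <= C * (1 - cos (u - x))).
      { apply Rle_trans with (C * (1 - cos e)); [unfold C; apply Req_le; field; lra | nra]. }
      pose proof (Hxm u Hu). pose proof (Hxm x Hx).
      unfold Rminus at 1. eapply Rle_trans; [apply Rabs_triang|]. rewrite Rabs_Ropp.
      unfold B in *. lra. }
    assert (Hcase : forall y, e <= y <= 2 * PI - e -> cos y <= cos e).
    { intros y Hy. destruct (Rle_dec y PI).
      - destruct (Req_dec y e) as [->|]; [lra|].
        apply Rlt_le, cos_decreasing_1; lra.
      - replace (cos y) with (cos (2 * PI - y)).
        + destruct (Req_dec (2 * PI - y) e) as [->|]; [lra|].
          apply Rlt_le, cos_decreasing_1; lra.
        + rewrite <- (cos_neg y), <- (cos_period (- y) 1). f_equal. simpl; ring. }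
    (* Points near opposite ends of the period are close after a shift of [u]. *)
    destruct (Rlt_dec (Rabs (u - x)) e) as [H1|H1]; [apply (Hnear u); auto; lra|].
    destruct (Rlt_dec (Rabs (u - x)) (2 * PI - e)) as [H2|H2].
    - apply Hfar. destruct (Rle_dec 0 (u - x)) as [H3|H3].
      + rewrite Rabs_right in * by lra. apply Hcase; lra.
      + rewrite Rabs_left in * by lra. rewrite <- cos_neg. apply Hcase; lra.
    - destruct (Rle_dec 0 (u - x)) as [H3|H3].
      + rewrite Rabs_right in * by lra. destruct (Req_dec (u - x) (2 * PI - e)) as [E|E].
        * apply Hfar, Hcase; lra.
        * apply (Hnear (u - 2 * PI)); [lra | | apply Rabs_def1; lra].
          rewrite <- (Hper (u - 2 * PI)). f_equal; ring.
      + rewrite Rabs_left in * by lra. destruct (Req_dec (- (u - x)) (2 * PI - e)) as [E|E].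
        * apply Hfar. rewrite <- cos_neg. apply Hcase; lra.
        * apply (Hnear (u + 2 * PI)); [lra | apply Hper | apply Rabs_def1; lra]. }
  exists (2 * B / (1 - cos e)). split.
  { apply Rmult_le_pos; [lra | apply Rlt_le, Rinv_0_lt_compat; lra]. }
  intros x u. destruct (reduce_to_period x) as [z Hz]. destruct (reduce_to_period u) as [z' Hz'].
  pose proof (Core _ _ Hz Hz') as H. rewrite !(periodic_IZR g Hper) in H.
  replace (cos (u + 2 * PI * IZR z' - (x + 2 * PI * IZR z))) with (cos (u - x)) in H; [exact H|].
  rewrite <- (periodic_IZR cos) with (z := (z' - z)%Z).
  - f_equal. rewrite minus_IZR. ring.
  - intros y. rewrite <- (cos_period y 1). f_equal. simpl; ring.
Qed.

(** The modulus of continuity of [periodic_modulus] is integrated against the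
    nonnegative kernel, where its term [1 - cos] is of size [2 / n] by
    [fejer_concentrated]. *)
Lemma fejer_theorem g p phi :
  (forall x, continuous g x) -> (forall x, g (x + 2 * PI) = g x) -> real_fourier g p phi ->
  forall eps, 0 < eps -> exists C, 0 <= C /\ forall n x, (1 <= n)%nat ->
    Rabs (p 0%nat + trig (fun k => (1 - INR k / INR n) * p k) phi (seq 1 n) x - g x)
    <= eps + C / INR n.
Proof.
  intros Hc Hper HF eps Heps. pose proof PI_RGT_0 as HPI.
  destruct (periodic_modulus g Hc Hper eps Heps) as [C [HC Hmod]].
  exists (2 * C). split; [lra|]. intros n x Hn.
  set (s := p 0%nat + trig _ phi (seq 1 n) x).
  assert (HI : is_RInt (fun u => (g u - g x) * fejer n (x - u)) 0 (2 * PI)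
    (1 * (2 * PI * s) + - g x * (2 * PI))).
  { apply (is_RInt_ext (fun u => 1 * (g u * fejer n (x - u)) + - g x * fejer n (x - u))).
    - intros u _. simpl. ring.
    - apply is_RInt_lincomb; [now apply is_RInt_fejer_conv | apply is_RInt_fejer]. }
  assert (HJ : forall c, is_RInt (fun u => c * (eps * fejer n (x - u) + 2 * C / INR n)) 0 (2 * PI)
    (c * (eps * (2 * PI) + 1 * (2 * PI * (2 * C / INR n))))).
  { intros c. apply (is_RInt_ext (fun u => c * (eps * fejer n (x - u) + 1 * (2 * C / INR n)))).
    - intros u _. simpl. ring.
    - apply @is_RInt_scal. apply is_RInt_lincomb; [apply is_RInt_fejer | apply is_RInt_cst]. }
  assert (Hpt : forall u, Rabs ((g u - g x) * fejer n (x - u))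
     <= eps * fejer n (x - u) + 2 * C / INR n).
  { intros u. pose proof (fejer_nonneg n (x - u) Hn) as Hnn.
    pose proof (fejer_concentrated n (x - u) Hn) as Hcc.
    rewrite Rabs_mult, (Rabs_right (fejer _ _)) by lra.
    apply Rle_trans with ((eps + C * (1 - cos (x - u))) * fejer n (x - u)).
    - apply Rmult_le_compat_r; [exact Hnn|].
      replace (x - u) with (- (u - x)) by ring. rewrite cos_neg. apply Hmod.
    - replace (2 * C / INR n) with (C * (2 / INR n)) by (field; apply not_0_INR; lia).
      rewrite Rmult_plus_distr_r, Rmult_assoc.
      apply Rplus_le_compat_l, Rmult_le_compat_l; assumption. }
  assert (Hup := is_RInt_le _ _ 0 (2 * PI) _ _ ltac:(lra) HI (HJ 1)).
  assert (Hlo := is_RInt_le _ _ 0 (2 * PI) _ _ ltac:(lra) (HJ (-1)) HI).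
  assert (Hu : forall u, 0 < u < 2 * PI -> (g u - g x) * fejer n (x - u)
    <= 1 * (eps * fejer n (x - u) + 2 * C / INR n)).
  { intros u _. specialize (Hpt u). apply Rabs_le_between in Hpt. lra. }
  assert (Hl : forall u, 0 < u < 2 * PI -> -1 * (eps * fejer n (x - u) + 2 * C / INR n)
    <= (g u - g x) * fejer n (x - u)).
  { intros u _. specialize (Hpt u). apply Rabs_le_between in Hpt. lra. }
  specialize (Hup Hu). specialize (Hlo Hl).
  apply Rabs_le. split; apply (Rmult_le_reg_l (2 * PI)); lra.
Qed.

(** The combination [2 sigma_(2N) - sigma_N] of Fejer means. *)
Lemma vallee_poussin_theorem g p phi :
  (forall x, continuous g x) -> (forall x, g (x + 2 * PI) = g x) -> real_fourier g p phi ->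
  forall eps, 0 < eps -> exists C, 0 <= C /\ forall N x, (1 <= N)%nat ->
    Rabs (p 0%nat + trig p phi (seq 1 N) x
      + trig (fun k => INR (2 * N - k) / INR N * p k) phi (seq (1 + N) N) x - g x)
    <= eps + C / INR N.
Proof.
  intros Hc Hper HF eps Heps.
  destruct (fejer_theorem g p phi Hc Hper HF (eps / 3) ltac:(lra)) as [C [HC H]].
  exists (2 * C). split; [lra|]. intros N x HN.
  assert (HN0 : 0 < INR N) by (apply lt_0_INR; lia).
  pose proof (H N x HN) as H1. pose proof (H (2 * N)%nat x ltac:(lia)) as H2.
  assert (E : trig p phi (seq 1 N) x
      + trig (fun k => INR (2 * N - k) / INR N * p k) phi (seq (1 + N) N) x
    = 2 * trig (fun k => (1 - INR k / INR (2 * N)) * p k) phi (seq 1 (2 * N)) x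
      - trig (fun k => (1 - INR k / INR N) * p k) phi (seq 1 N) x).
  { assert (Es : seq 1 (2 * N) = seq 1 N ++ seq (1 + N) N)
      by (rewrite <- seq_app; f_equal; lia).
    rewrite Es. unfold trig. rewrite lsum_app, Rmult_plus_distr_l, <- !lsum_scal.
    enough (E1 : lsum (fun k => p k * cos (INR k * x + phi k)) (seq 1 N) =
      lsum (fun u => 2 * ((1 - INR u / INR (2 * N)) * p u * cos (INR u * x + phi u))) (seq 1 N)
      - lsum (fun k => (1 - INR k / INR N) * p k * cos (INR k * x + phi k)) (seq 1 N)).
    - rewrite E1.
      rewrite (lsum_ext (fun k => INR (2 * N - k) / INR N * _ * _)
        (fun u => 2 * ((1 - INR u / INR (2 * N)) * p u * cos (INR u * x + phi u)))); [ring|].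
      intros k Hk. apply in_seq in Hk. rewrite minus_INR, mult_INR by lia.
      simpl (INR 2). field. lra.
    - rewrite <- lsum_minus. apply lsum_ext. intros k _. rewrite mult_INR.
      simpl (INR 2). field. lra. }
  replace (p 0%nat + _ + _ - _) with
    (2 * (p 0%nat + trig (fun k => (1 - INR k / INR (2 * N)) * p k) phi (seq 1 (2 * N)) x - g x)
     - (p 0%nat + trig (fun k => (1 - INR k / INR N) * p k) phi (seq 1 N) x - g x)) by lra.
  replace (C / INR (2 * N)) with (C / INR N / 2) in H2
    by (rewrite mult_INR; simpl (INR 2); field; lra).
  replace (2 * C / INR N) with (2 * (C / INR N)) by (field; lra).
  apply Rabs_le_between in H1, H2. apply Rabs_le. lra.
Qed.

(** Subtracting the next term of the series from the remainder lowers the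
    integral of the square by [PI * p k ^ 2]. *)
Lemma bessel_inequality g p phi :
  (forall x, continuous g x) -> real_fourier g p phi ->
  exists I, forall n, lsum (fun k => p k ^ 2) (seq 1 n) <= I.
Proof.
  intros Hc [_ Hk]. pose proof PI_RGT_0 as HPI.
  assert (exists I : R, is_RInt (fun u => g u * g u) 0 (2 * PI) I) as [I HI].
  { apply (ex_RInt_continuous (V := R_CompleteNormedModule)).
    intros u _. apply (continuous_mult g g); apply Hc. }
  assert (Hcoef : forall k, (1 <= k)%nat ->
    is_RInt (fun u => g u * cos (INR k * u + phi k)) 0 (2 * PI) (PI * p k)).
  { intros k H1. assert (0 < INR k) by (apply lt_0_INR; lia).
    (* At this point the term of frequency [k] attains its amplitude. *)
    replace (PI * p k) with (PI * (p k * cos (INR k * (- phi k / INR k) + phi k))).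
    - apply (is_RInt_ext (fun u => g u * cos (INR k * (- phi k / INR k - u)))); [|now apply Hk].
      intros u _. apply f_equal. rewrite <- cos_neg. apply f_equal. field. lra.
    - replace (INR k * (- phi k / INR k) + phi k) with 0 by (field; lra). rewrite cos_0. ring. }
  assert (Hort : forall n k, (n < k)%nat -> is_RInt (fun u =>
    (g u - trig p phi (seq 1 n) u) * cos (INR k * u + phi k)) 0 (2 * PI) (PI * p k)).
  { intros n k Hnk.
    replace (PI * p k) with (1 * (PI * p k) + -1 * lsum (fun _ => 0) (seq 1 n))
      by (rewrite lsum_const; ring).
    apply (is_RInt_ext (fun u => 1 * (g u * cos (INR k * u + phi k)) + -1 *
      lsum (fun l => p l * (cos (INR l * u + phi l) * cos (INR k * u + phi k))) (seq 1 n))).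
    - intros u _. unfold trig. simpl.
      rewrite (lsum_ext _ (fun l => cos (INR k * u + phi k) * (p l * cos (INR l * u + phi l))))
        by (intros; ring).
      rewrite lsum_scal. ring.
    - apply is_RInt_lincomb; [apply Hcoef; lia|]. apply is_RInt_lsum. intros l Hl.
      apply in_seq in Hl. replace 0 with (p l * 0) at 2 by ring.
      apply @is_RInt_scal. apply is_RInt_cos_cos; lia. }
  assert (Hres : forall n, is_RInt (fun u =>
    (g u - trig p phi (seq 1 n) u) * (g u - trig p phi (seq 1 n) u)) 0 (2 * PI)
    (I - PI * lsum (fun k => p k ^ 2) (seq 1 n))).
  { induction n as [|n IH].
    - simpl. replace (I - PI * 0) with I by ring.
      apply (is_RInt_ext (fun u => g u * g u)); [|exact HI].
      intros u _. unfold trig. simpl. ring.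
    - rewrite seq_S, lsum_app. cbn [lsum]. replace (1 + n)%nat with (S n) by lia.
      set (e := fun u => cos (INR (S n) * u + phi (S n))).
      set (r := fun u => g u - trig p phi (seq 1 n) u) in *.
      replace (I - PI * (lsum (fun k => p k ^ 2) (seq 1 n) + (p (S n) ^ 2 + 0)))
        with (1 * (I - PI * lsum (fun k => p k ^ 2) (seq 1 n))
          + 1 * (- 2 * p (S n) * (PI * p (S n)) + p (S n) ^ 2 * PI)) by ring.
      apply (is_RInt_ext (fun u => 1 * (r u * r u) + 1 *
        (- 2 * p (S n) * (r u * e u) + p (S n) ^ 2 * (e u * e u)))).
      + intros u _. unfold trig. rewrite lsum_app. cbn [lsum].
        unfold r, e, trig. simpl. ring.
      + apply is_RInt_lincomb; [exact IH|].
        apply is_RInt_lincomb; [apply Hort; lia | apply is_RInt_cos_sqr; lia]. }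
  exists (I / PI). intros n. apply Rle_div_r; [exact HPI|].
  assert (0 <= I - PI * lsum (fun k => p k ^ 2) (seq 1 n)); [|lra].
  refine (is_RInt_le (fun _ => 0) _ 0 (2 * PI) _ _ ltac:(lra) _ (Hres n) _).
  - rewrite <- (Rmult_0_r (2 * PI)) at 2. apply is_RInt_cst.
  - intros u _. apply Rle_0_sqr.
Qed.

(** * Complex functions and their real and imaginary parts *)

Lemma Cmod_le_parts z : Cmod z <= Rabs (fst z) + Rabs (snd z).
Proof.
  unfold Cmod. pose proof (Rabs_pos (fst z)). pose proof (Rabs_pos (snd z)).
  rewrite <- (sqrt_pow2 (Rabs (fst z) + Rabs (snd z))) by lra.
  apply sqrt_le_1_alt. rewrite <- (pow2_abs (fst z)), <- (pow2_abs (snd z)). nra.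
Qed.

Lemma Cmod_sqr z : Cmod z ^ 2 = fst z ^ 2 + snd z ^ 2.
Proof.
  unfold Cmod. apply pow2_sqrt.
  pose proof (pow2_ge_0 (fst z)). pose proof (pow2_ge_0 (snd z)). lra.
Qed.

Lemma fourier_coef_parts f k Gc Gs Hc Hs :
  is_RInt (fun u => fst (f u) * cos (IZR k * u)) 0 (2 * PI) Gc ->
  is_RInt (fun u => fst (f u) * sin (IZR k * u)) 0 (2 * PI) Gs ->
  is_RInt (fun u => snd (f u) * cos (IZR k * u)) 0 (2 * PI) Hc ->
  is_RInt (fun u => snd (f u) * sin (IZR k * u)) 0 (2 * PI) Hs ->
  fourier_coef f k = (/ (2 * PI) * (Gc + Hs), / (2 * PI) * (Hc - Gs)).
Proof.
  intros H1 H2 H3 H4. unfold fourier_coef.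
  rewrite (is_RInt_unique (V := C_R_CompleteNormedModule) _ _ _ (Gc + Hs, Hc - Gs)).
  - unfold Cmult, RtoC. simpl. f_equal; ring.
  - apply (is_RInt_fct_extend_pair (U := R_NormedModule) (V := R_NormedModule)).
    + apply (is_RInt_ext (fun u => fst (f u) * cos (IZR k * u) + snd (f u) * sin (IZR k * u))).
      * intros u _. unfold expi. simpl. rewrite cos_neg, sin_neg. ring.
      * now apply @is_RInt_plus.
    + apply (is_RInt_ext (fun u => minus (snd (f u) * cos (IZR k * u)) (fst (f u) * sin (IZR k * u)))).
      * intros u _. unfold expi, minus, plus, opp. simpl. rewrite cos_neg, sin_neg. ring.
      * now apply @is_RInt_minus.
Qed.

(** The terms of frequency [k] and [- k] add up to
    [1 / PI] times the integral of [f u * cos (k (x - u))], and this formula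
    splits into real and imaginary parts because the phases are real. *)
Lemma real_fourier_parts (f : R -> C) (A : nat -> R -> C) (d : nat -> C) (phi : nat -> R) :
  (forall x, continuous f x) -> has_fourier_series f A ->
  (forall x, A 0%nat x = d 0%nat) ->
  (forall (k : nat) x, (1 <= k)%nat -> A k x = Cmult (d k) (RtoC (cos (INR k * x + phi k)))) ->
  real_fourier (fun x => fst (f x)) (fun k => fst (d k)) phi /\
  real_fourier (fun x => snd (f x)) (fun k => snd (d k)) phi.
Proof.
  intros Hf [HA1 HA2] H0 Hk. pose proof PI_RGT_0 as HPI.
  assert (Hg : forall x, continuous (fun x => fst (f x)) x)
    by (intros x; apply (continuous_comp f fst); [apply Hf | apply continuous_fst]).
  assert (Hh : forall x, continuous (fun x => snd (f x)) x)
    by (intros x; apply (continuous_comp f snd); [apply Hf | apply continuous_snd]).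
  assert (Hex : forall (g t : R -> R), (forall x, continuous g x) ->
    (forall x, continuous t x) -> exists I : R, is_RInt (fun u => g u * t u) 0 (2 * PI) I).
  { intros g t Cg Ct. apply (ex_RInt_continuous (V := R_CompleteNormedModule)).
    intros u _. apply (continuous_mult g t); auto. }
  assert (Hcos : forall a x, continuous (fun u => cos (a * u)) x)
    by (intros a x; apply (ex_derive_continuous (V := R_NormedModule)); auto_derive; trivial).
  assert (Hsin : forall a x, continuous (fun u => sin (a * u)) x)
    by (intros a x; apply (ex_derive_continuous (V := R_NormedModule)); auto_derive; trivial).
  assert (Hcoef : forall k : nat, exists Gc Gs Hc Hs : R,
    is_RInt (fun u => fst (f u) * cos (INR k * u)) 0 (2 * PI) Gc /\
    is_RInt (fun u => fst (f u) * sin (INR k * u)) 0 (2 * PI) Gs /\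
    is_RInt (fun u => snd (f u) * cos (INR k * u)) 0 (2 * PI) Hc /\
    is_RInt (fun u => snd (f u) * sin (INR k * u)) 0 (2 * PI) Hs /\
    fourier_coef f (Z.of_nat k) = (/ (2 * PI) * (Gc + Hs), / (2 * PI) * (Hc - Gs)) /\
    fourier_coef f (- Z.of_nat k) = (/ (2 * PI) * (Gc - Hs), / (2 * PI) * (Hc + Gs))).
  { intros k.
    destruct (Hex _ _ Hg (Hcos (INR k))) as [Gc I1]. destruct (Hex _ _ Hg (Hsin (INR k))) as [Gs I2].
    destruct (Hex _ _ Hh (Hcos (INR k))) as [Hc I3]. destruct (Hex _ _ Hh (Hsin (INR k))) as [Hs I4].
    exists Gc, Gs, Hc, Hs. do 4 (split; [assumption|]). split.
    - apply fourier_coef_parts; rewrite <- INR_IZR_INZ; assumption.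
    - replace (Gc - Hs) with (Gc + - Hs) by ring. replace (Hc + Gs) with (Hc - - Gs) by ring.
      assert (Neg : forall (g : R -> R) (I : R), is_RInt (fun u => g u * sin (INR k * u)) 0 (2 * PI) I ->
        is_RInt (fun u => g u * sin (IZR (- Z.of_nat k) * u)) 0 (2 * PI) (- I)).
      { intros g I HI. apply (is_RInt_ext (fun u => opp (g u * sin (INR k * u)))).
        - intros u _. rewrite opp_IZR, <- INR_IZR_INZ, <- Ropp_mult_distr_l, sin_neg.
          unfold opp; simpl; ring.
        - now apply @is_RInt_opp. }
      assert (Pos : forall (g : R -> R) (I : R), is_RInt (fun u => g u * cos (INR k * u)) 0 (2 * PI) I ->
        is_RInt (fun u => g u * cos (IZR (- Z.of_nat k) * u)) 0 (2 * PI) I).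
      { intros g I HI. apply (is_RInt_ext (fun u => g u * cos (INR k * u))); [|exact HI].
        intros u _. rewrite opp_IZR, <- INR_IZR_INZ, <- Ropp_mult_distr_l, cos_neg. reflexivity. }
      apply fourier_coef_parts; auto. }
  assert (Comb : forall (g : R -> R) (k : nat) (x Ic Is v : R),
    is_RInt (fun u => g u * cos (INR k * u)) 0 (2 * PI) Ic ->
    is_RInt (fun u => g u * sin (INR k * u)) 0 (2 * PI) Is ->
    v = cos (INR k * x) * Ic + sin (INR k * x) * Is ->
    is_RInt (fun u => g u * cos (INR k * (x - u))) 0 (2 * PI) v).
  { intros g k x Ic Is v I1 I2 ->.
    apply (is_RInt_ext (fun u => cos (INR k * x) * (g u * cos (INR k * u))
      + sin (INR k * x) * (g u * sin (INR k * u)))).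
    - intros u _. rewrite Rmult_minus_distr_l, cos_minus. simpl. ring.
    - now apply is_RInt_lincomb. }
  destruct (Hcoef 0%nat) as [Gc [Gs [Hc [Hs [I1 [I2 [I3 [I4 [E1 _]]]]]]]]].
  assert (Zs : forall (g : R -> R) (I : R), is_RInt (fun u => g u * sin (INR 0 * u)) 0 (2 * PI) I -> I = 0).
  { intros g I HI.
    assert (HI0 : is_RInt (fun u => g u * sin (INR 0 * u)) 0 (2 * PI) 0).
    { apply (is_RInt_ext (fun _ => 0)).
      - intros u _. simpl. rewrite Rmult_0_l, sin_0. ring.
      - rewrite <- (Rmult_0_r (2 * PI)) at 2. apply is_RInt_cst. }
    rewrite <- (is_RInt_unique (V := R_CompleteNormedModule) _ _ _ _ HI).
    exact (is_RInt_unique (V := R_CompleteNormedModule) _ _ _ _ HI0). }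
  apply Zs in I2, I4. subst Gs Hs.
  specialize (HA1 0). rewrite (H0 0) in HA1. simpl Z.of_nat in E1. rewrite E1 in HA1.
  assert (Zc : forall (g : R -> R) (I : R), is_RInt (fun u => g u * cos (INR 0 * u)) 0 (2 * PI) I ->
    is_RInt g 0 (2 * PI) I).
  { intros g I HI. apply (is_RInt_ext (fun u => g u * cos (INR 0 * u))); [|exact HI].
    intros u _. simpl. rewrite Rmult_0_l, cos_0. ring. }
  split; split.
  - rewrite HA1. simpl. replace (2 * PI * (/ (2 * PI) * (Gc + 0))) with Gc by (field; lra). auto.
  - intros k x H1. destruct (Hcoef k) as [Gc' [Gs' [Hc' [Hs' [J1 [J2 [J3 [J4 [F1 F2]]]]]]]]].
    apply (Comb (fun u => fst (f u)) k x Gc' Gs'); [assumption | assumption|].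
    specialize (HA2 k x H1). rewrite Hk, F1, F2 in HA2 by exact H1.
    apply (f_equal fst) in HA2. unfold Cplus, Cmult, RtoC, expi in HA2. simpl in HA2.
    rewrite cos_neg, sin_neg in HA2.
    replace (fst (d k) * cos (INR k * x + phi k)) with
      (fst (d k) * cos (INR k * x + phi k) - snd (d k) * 0) by ring.
    rewrite HA2. field. lra.
  - rewrite HA1. simpl. replace (2 * PI * (/ (2 * PI) * (Hc - 0))) with Hc by (field; lra). auto.
  - intros k x H1. destruct (Hcoef k) as [Gc' [Gs' [Hc' [Hs' [J1 [J2 [J3 [J4 [F1 F2]]]]]]]]].
    apply (Comb (fun u => snd (f u)) k x Hc' Hs'); [assumption | assumption|].
    specialize (HA2 k x H1). rewrite Hk, F1, F2 in HA2 by exact H1.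
    apply (f_equal snd) in HA2. unfold Cplus, Cmult, RtoC, expi in HA2. simpl in HA2.
    rewrite cos_neg, sin_neg in HA2.
    replace (snd (d k) * cos (INR k * x + phi k)) with
      (fst (d k) * 0 + snd (d k) * cos (INR k * x + phi k)) by ring.
    rewrite HA2. field. lra.
Qed.

Lemma unif_norm_bounds g B : (forall x, Cmod (g x) <= B) ->
  0 <= unif_norm g <= B /\ forall x, Cmod (g x) <= unif_norm g.
Proof.
  intros HB. unfold unif_norm.
  set (E := fun r : R => exists x : R, r = Cmod (g x)).
  destruct (Lub_Rbar_correct E) as [Hub Hleast].
  assert (H0 : Rbar_le (Cmod (g 0)) (Lub_Rbar E)) by (apply Hub; now exists 0).
  assert (H1 : Rbar_le (Lub_Rbar E) B).
  { apply Hleast. intros r [x ->]. apply HB. }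
  destruct (Lub_Rbar E) as [l| |] eqn:El; simpl in *; try contradiction.
  pose proof (Cmod_ge_0 (g 0)). split; [lra|].
  intros x. apply (Hub (Cmod (g x))). now exists x.
Qed.

Lemma sum_n_m_parts (a : nat -> C) n :
  sum_n_m a 1 n = (lsum (fun k => fst (a k)) (seq 1 n), lsum (fun k => snd (a k)) (seq 1 n)).
Proof.
  induction n as [|n IH].
  - rewrite sum_n_m_zero by lia. reflexivity.
  - rewrite sum_n_Sm by lia. rewrite IH, seq_S, !lsum_app. cbn [lsum].
    replace (1 + n)%nat with (S n) by lia.
    unfold plus; simpl. unfold Cplus; simpl. now rewrite !Rplus_0_r.
Qed.

(** * Sequences of uniform error bounds *)

Lemma inv_pow2_le eps : 0 < eps -> exists J : nat, forall j : nat, (J <= j)%nat -> / 2 ^ j <= eps.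
Proof.
  intros He. destruct (nfloor_ex (/ eps)) as [J [_ HJ]].
  { apply Rlt_le, Rinv_0_lt_compat, He. }
  exists (S J). intros j Hj. rewrite <- (Rinv_inv eps).
  apply Rinv_le_contravar; [now apply Rinv_0_lt_compat|].
  assert (INR j <= 2 ^ j).
  { clear. induction j as [|j IH]; [simpl; lra|]. rewrite S_INR. simpl.
    assert (1 <= 2 ^ j) by (apply pow_R1_Rle; lra). lra. }
  assert (INR (S J) <= INR j) by (apply le_INR; exact Hj). rewrite S_INR in *. lra.
Qed.

(** Turns bounds with an unspecified rate into one sequence of bounds. *)
Lemma uniform_error_sequence (h : nat -> R -> R) :
  (forall eps, 0 < eps -> exists C, 0 <= C /\ forall j x, Rabs (h j x) <= eps + C * / 2 ^ j) ->
  exists e : nat -> R, is_lim_seq e 0 /\ forall j x, Rabs (h j x) <= e j.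
Proof.
  intros H. exists (fun j => unif_norm (fun x => RtoC (h j x))). split.
  - apply is_lim_seq_spec. intros [eps Heps]. simpl.
    destruct (H (eps / 3) ltac:(lra)) as [C [HC HB]].
    destruct (inv_pow2_le (eps / 3 / (C + 1))) as [J HJ].
    { apply Rdiv_lt_0_compat; lra. }
    exists J. intros j Hj. rewrite Rminus_0_r.
    destruct (unif_norm_bounds (fun x => RtoC (h j x)) (2 * (eps / 3))) as [[U1 U2] _].
    + intros x. rewrite Cmod_R. eapply Rle_trans; [apply HB|].
      specialize (HJ j Hj).
      assert (0 < / 2 ^ j) by (apply Rinv_0_lt_compat, pow_lt; lra).
      assert ((C + 1) * / 2 ^ j <= eps / 3).
      { apply (Rmult_le_compat_l (C + 1)) in HJ; [|lra].
        replace ((C + 1) * (eps / 3 / (C + 1))) with (eps / 3) in HJ by (field; lra). exact HJ. }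
      nra.
    + rewrite Rabs_right by lra. lra.
  - intros j x. destruct (H 1 Rlt_0_1) as [C [HC HB]].
    rewrite <- Cmod_R.
    destruct (unif_norm_bounds (fun x => RtoC (h j x)) (1 + C * / 2 ^ j)) as [_ U].
    + intros y. rewrite Cmod_R. apply HB.
    + apply U.
Qed.

(** * Enumerating the positive integers along a chain of finite sets *)

(** The lists [W j] extend one another, so the entry at a given position does not
    depend on [j]; as [W k] has more than [k] entries, [W k] can serve to define
    [sigma k]. *)
Lemma enumeration_of_chain (W L : nat -> list nat) :
  (forall j, W (S j) = W j ++ L j) ->
  (forall j, exists P, Permutation (W j) (seq 1 (2 ^ j) ++ P) /\ NoDup P /\
     forall k, In k P -> (2 ^ j < k)%nat) ->
  exists sigma, permutation_pos sigma /\
    forall n j, (n <= length (W j))%nat -> map sigma (seq 1 n) = firstn n (W j).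
Proof.
  intros HW HP.
  assert (Hpow : forall j, (j < 2 ^ j)%nat) by (intros; apply Nat.pow_gt_lin_r; lia).
  assert (Hlen : forall j, (j < length (W j))%nat).
  { intros j. destruct (HP j) as [P [Hp _]].
    rewrite (Permutation_length Hp), length_app, length_seq. specialize (Hpow j). lia. }
  assert (Hnd : forall j, NoDup (W j)).
  { intros j. destruct (HP j) as [P [Hp [Hn Hk]]].
    apply (Permutation_NoDup (Permutation_sym Hp)). apply NoDup_app.
    - apply seq_NoDup.
    - exact Hn.
    - intros k Hk1 Hk2. apply in_seq in Hk1. specialize (Hk k Hk2). lia. }
  assert (Hpre : forall i j, (i <= j)%nat -> exists R, W j = W i ++ R).
  { intros i j Hij. induction Hij as [|j Hij [R ER]].
    - exists []. now rewrite app_nil_r.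
    - exists (R ++ L j). now rewrite HW, ER, app_assoc. }
  assert (Hnth : forall i j p, (p < length (W i))%nat -> (p < length (W j))%nat ->
    nth p (W i) 0%nat = nth p (W j) 0%nat).
  { intros i j p Hi Hj. destruct (le_lt_dec i j) as [H|H].
    - destruct (Hpre i j H) as [R ->]. now rewrite app_nth1.
    - destruct (Hpre j i ltac:(lia)) as [R ->]. now rewrite app_nth1. }
  exists (fun k => nth (k - 1) (W k) 0%nat). split; [split; [|split]|].
  - intros k Hk. pose proof (Hlen k) as Hl.
    assert (Hin : In (nth (k - 1) (W k) 0%nat) (W k)) by (apply nth_In; lia).
    destruct (HP k) as [P [Hp [_ Hbig]]]. apply (Permutation_in _ Hp) in Hin.
    apply in_app_or in Hin. destruct Hin as [Hin|Hin].
    + apply in_seq in Hin; lia.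
    + apply Hbig in Hin; lia.
  - intros j k Hj Hk E. pose proof (Hlen j). pose proof (Hlen k).
    set (m := Nat.max j k). pose proof (Hlen m).
    rewrite (Hnth j m), (Hnth k m) in E by lia.
    apply (proj1 (NoDup_nth (W m) 0%nat) (Hnd m)) in E; lia.
  - intros m Hm. specialize (Hpow m).
    assert (Hin : In m (W m)).
    { destruct (HP m) as [P [Hp _]]. apply (Permutation_in _ (Permutation_sym Hp)).
      apply in_or_app. left. apply in_seq. lia. }
    apply (In_nth _ _ 0%nat) in Hin. destruct Hin as [p [Hp E]].
    exists (S p). split; [lia|]. pose proof (Hlen (S p)).
    replace (S p - 1)%nat with p by lia. rewrite <- E. apply Hnth; lia.
  - intros n j Hn. apply (nth_ext _ _ 0%nat 0%nat).
    + rewrite length_map, length_seq, length_firstn. lia.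
    + intros p Hp. rewrite length_map, length_seq in Hp.
      rewrite nth_indep with (d' := (fun k => nth (k - 1) (W k) 0%nat) 0%nat)
        by (rewrite length_map, length_seq; exact Hp).
      rewrite (map_nth (fun k => nth (k - 1) (W k) 0%nat)), seq_nth by exact Hp.
      rewrite nth_firstn. destruct (Nat.ltb_spec p n); [|lia].
      replace (1 + p - 1)%nat with p by lia.
      pose proof (Hlen (1 + p)%nat). apply Hnth; lia.
Qed.

(** * Dyadic blocks of frequencies *)

Definition energy (p q : nat -> R) (k : nat) : R := p k ^ 2 + q k ^ 2.

Lemma energy_nonneg p q k : 0 <= energy p q k.
Proof. unfold energy. pose proof (pow2_ge_0 (p k)). pose proof (pow2_ge_0 (q k)). lra. Qed.

(** The tails of the convergent series of energies bound the block sums; the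
    added term [1 / (j + 1)] makes the bounds positive. *)
Lemma energy_tails p q I : (forall n, lsum (energy p q) (seq 1 n) <= I) ->
  exists S : nat -> R, (forall j, 0 < S j) /\ is_lim_seq S 0 /\
    forall j, lsum (energy p q) (seq (1 + 2 ^ j) (3 * 2 ^ j)) <= S j.
Proof.
  intros HI. set (F := fun n => lsum (energy p q) (seq 1 n)).
  assert (Hstep : forall a b, (a <= b)%nat ->
    F b = F a + lsum (energy p q) (seq (1 + a) (b - a))).
  { intros a b Hab. unfold F. replace b with (a + (b - a))%nat at 1 by lia.
    now rewrite seq_app, lsum_app. }
  assert (Hmono : forall a b, (a <= b)%nat -> F a <= F b).
  { intros a b Hab. rewrite (Hstep a b Hab).
    assert (0 <= lsum (energy p q) (seq (1 + a) (b - a)))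
      by (apply lsum_nonneg; intros; apply energy_nonneg). lra. }
  destruct (ex_finite_lim_seq_incr F I) as [l Hl].
  { intros n. apply Hmono. lia. }
  { intros n. apply HI. }
  assert (Hle : forall n, F n <= l).
  { intros n. apply (is_lim_seq_incr_compare F l Hl). intros k. apply Hmono; lia. }
  assert (Hsub : is_lim_seq (fun j => F (2 ^ j)%nat) l).
  { apply (is_lim_seq_le_le F _ (fun _ => l)).
    - intros j. split; [|apply Hle]. apply Hmono.
      pose proof (Nat.pow_gt_lin_r 2 j). lia.
    - exact Hl.
    - apply is_lim_seq_const. }
  exists (fun j => l - F (2 ^ j)%nat + / (INR j + 1)). split; [|split].
  - intros j. pose proof (Hle (2 ^ j)%nat). pose proof (pos_INR j).
    assert (0 < / (INR j + 1)) by (apply Rinv_0_lt_compat; lra). lra.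
  - replace (Finite 0) with (Finite (l - l + 0)) by (f_equal; ring).
    apply is_lim_seq_plus'.
    + apply is_lim_seq_minus'; [apply is_lim_seq_const | exact Hsub].
    + apply (is_lim_seq_ext (fun n => / INR (S n))); [intros; now rewrite S_INR|].
      apply (is_lim_seq_incr_1 (fun n => / INR n)).
      replace (Finite 0) with (Rbar_inv p_infty) by reflexivity.
      apply is_lim_seq_inv; [apply is_lim_seq_INR | discriminate].
  - intros j. pose proof (Hstep (2 ^ j)%nat (4 * 2 ^ j)%nat ltac:(lia)) as H.
    replace (4 * 2 ^ j - 2 ^ j)%nat with (3 * 2 ^ j)%nat in H by lia.
    pose proof (Hle (4 * 2 ^ j)%nat). pose proof (pos_INR j).
    assert (0 < / (INR j + 1)) by (apply Rinv_0_lt_compat; lra). lra.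
Qed.

Lemma disc_lim_0 M0 b (S : nat -> R) : is_lim_seq S 0 ->
  is_lim_seq (fun j => disc M0 (S j) b) 0.
Proof.
  intros HS. unfold disc.
  assert (Hsqrt : forall u : nat -> R, is_lim_seq u 0 -> is_lim_seq (fun j => sqrt (u j)) 0).
  { intros u Hu. rewrite <- sqrt_0. apply (is_lim_seq_continuous sqrt u 0); [|exact Hu].
    apply continuity_pt_filterlim, continuous_sqrt. }
  apply Hsqrt.
  replace (Finite 0) with (Rbar_mult (128 * M0) 0) by (simpl; f_equal; ring).
  apply is_lim_seq_scal_l. apply Hsqrt.
  replace (Finite 0) with (Rbar_mult 0 b) by (simpl; f_equal; ring).
  now apply is_lim_seq_scal_r.
Qed.

(** The coordinates [t < 4 M] are the values on the grid of the term of frequency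
    [k] with coefficients [p], the next [4 M] those with coefficients [q]: one
    splitting has to control the real and the imaginary part at once. *)
Definition grid_weights (p q phi : nat -> R) (M t k : nat) : R :=
  if Nat.ltb t (4 * M) then p k * cos (INR k * grid_pt (4 * M) t + phi k)
  else q k * cos (INR k * grid_pt (4 * M) (t - 4 * M) + phi k).

Lemma grid_weights_re p q phi M t k : (t < 4 * M)%nat ->
  grid_weights p q phi M t k = p k * cos (INR k * grid_pt (4 * M) t + phi k).
Proof. intros H. unfold grid_weights. now destruct (Nat.ltb_spec t (4 * M)); [|lia]. Qed.

Lemma grid_weights_im p q phi M t k :
  grid_weights p q phi M (4 * M + t) k = q k * cos (INR k * grid_pt (4 * M) t + phi k).
Proof.
  unfold grid_weights. destruct (Nat.ltb_spec (4 * M + t) (4 * M)); [lia|].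
  now replace (4 * M + t - 4 * M)%nat with t by lia.
Qed.

Lemma grid_weights_sqr p q phi M t k : grid_weights p q phi M t k ^ 2 <= energy p q k.
Proof.
  assert (H : forall a c, (a * cos c) ^ 2 <= a ^ 2).
  { intros a c. rewrite Rpow_mult_distr. pose proof (COS_bound c). pose proof (pow2_ge_0 a).
    assert (cos c ^ 2 <= 1) by nra. nra. }
  unfold grid_weights, energy. pose proof (pow2_ge_0 (p k)). pose proof (pow2_ge_0 (q k)).
  destruct (Nat.ltb t (4 * M)).
  - pose proof (H (p k) (INR k * grid_pt (4 * M) t + phi k)). lra.
  - pose proof (H (q k) (INR k * grid_pt (4 * M) (t - 4 * M) + phi k)). lra.
Qed.

Lemma grid_weights_spread p q phi B S j T : 0 < B ->
  (forall k, (1 <= k)%nat -> energy p q k <= B / INR k) ->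
  lsum (energy p q) (seq (1 + 2 ^ j) (3 * 2 ^ j)) <= S ->
  NoDup T -> (forall k, In k T -> (2 ^ j < k <= 4 * 2 ^ j)%nat) ->
  spread (grid_weights p q phi (4 * 2 ^ j)) (8 * (4 * 2 ^ j)) (INR (4 * 2 ^ j)) S (4 * B) T.
Proof.
  intros HB Hen HS Hnd HT.
  assert (Hincl : incl T (seq (1 + 2 ^ j) (3 * 2 ^ j))).
  { intros k Hk. apply in_seq. specialize (HT k Hk). lia. }
  split; [|split].
  - apply le_INR. pose proof (NoDup_incl_length Hnd Hincl) as H. rewrite length_seq in H. lia.
  - intros t _. eapply Rle_trans; [|exact HS].
    apply Rle_trans with (lsum (energy p q) T).
    + apply lsum_le. intros; apply grid_weights_sqr.
    + apply lsum_incl; auto. intros; apply energy_nonneg.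
  - intros t k _ Hk. specialize (HT k Hk).
    eapply Rle_trans; [apply grid_weights_sqr|].
    eapply Rle_trans; [apply Hen; lia|].
    assert (0 < INR (2 ^ j)) by (apply lt_0_INR; lia).
    assert (INR (2 ^ j) <= INR k) by (apply le_INR; lia).
    rewrite mult_INR. replace (INR 4) with 4 by (simpl; ring).
    replace (4 * B / (4 * INR (2 ^ j))) with (B / INR (2 ^ j)) by (field; lra).
    apply Rmult_le_compat_l; [lra|]. apply Rinv_le_contravar; lra.
Qed.

Lemma two_pow_ge_1 j : (1 <= 2 ^ j)%nat.
Proof. pose proof (Nat.pow_nonzero 2 j). lia. Qed.

Lemma grid_count j : INR (8 * (4 * 2 ^ j)) <= 8 * INR (4 * 2 ^ j).
Proof. rewrite (mult_INR 8). replace (INR 8) with 8 by (simpl; ring). lra. Qed.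

Lemma lsum_grid_weights_re p q phi M T t : (t < 4 * M)%nat ->
  lsum (grid_weights p q phi M t) T = trig p phi T (grid_pt (4 * M) t).
Proof. intros H. apply lsum_ext. intros. now apply grid_weights_re. Qed.

Lemma lsum_grid_weights_im p q phi M T t :
  lsum (grid_weights p q phi M (4 * M + t)) T = trig q phi T (grid_pt (4 * M) t).
Proof. apply lsum_ext. intros. apply grid_weights_im. Qed.

(** With [N = 2 ^ j] the weights [(2 N - k) / N] of the de la Vallee Poussin mean
    are multiples of [2 ^ (- j)], so [dyadic_rounding] applies exactly. *)
Lemma block_rounding p q phi B S j : 0 < B -> 0 < S ->
  (forall k, (1 <= k)%nat -> energy p q k <= B / INR k) ->
  lsum (energy p q) (seq (1 + 2 ^ j) (3 * 2 ^ j)) <= S ->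
  exists P Q, Permutation (seq (1 + 2 ^ j) (2 ^ j)) (P ++ Q) /\
    forall r, r = p \/ r = q -> forall x,
      Rabs (trig r phi P x - trig (fun k => INR (2 * 2 ^ j - k) / INR (2 ^ j) * r k) phi
        (seq (1 + 2 ^ j) (2 ^ j)) x) <= 300 * disc 8 S (4 * B).
Proof.
  intros HB HS0 Hen HS.
  assert (Hp1 : (1 <= 2 ^ j)%nat) by apply two_pow_ge_1.
  set (T := map (fun k => (k, (2 * 2 ^ j - k)%nat)) (seq (1 + 2 ^ j) (2 ^ j))).
  assert (HT : map fst T = seq (1 + 2 ^ j) (2 ^ j)) by (unfold T; rewrite map_map; apply map_id).
  assert (Hpos : 0 < INR (4 * 2 ^ j)) by (apply lt_0_INR; lia).
  destruct (dyadic_rounding (grid_weights p q phi (4 * 2 ^ j)) (8 * (4 * 2 ^ j)) 8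
    (INR (4 * 2 ^ j)) S (4 * B) j ltac:(lra) Hpos HS0 ltac:(lra) (grid_count j) T) as [P [Q [HP HD]]].
  { rewrite HT. apply grid_weights_spread; auto; [apply seq_NoDup|].
    intros k Hk. apply in_seq in Hk. lia. }
  { intros ua Hu. unfold T in Hu. apply in_map_iff in Hu. destruct Hu as [k [<- Hk]].
    apply in_seq in Hk. simpl snd. lia. }
  rewrite HT in HP. exists P, Q. split; [exact HP|].
  assert (HK := disc_pos 8 S (4 * B) ltac:(lra) HS0 ltac:(lra)).
  assert (Hsmall : 100 * disc 8 S (4 * B) * (1 - / 2 ^ j) <= 100 * disc 8 S (4 * B)).
  { assert (0 < / 2 ^ j) by (apply Rinv_0_lt_compat, pow_lt; lra). nra. }
  assert (Hrange : forall k, In k (P ++ seq (1 + 2 ^ j) (2 ^ j)) -> (1 <= k <= 4 * 2 ^ j)%nat).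
  { intros k Hk. apply in_app_or in Hk.
    assert (In k (seq (1 + 2 ^ j) (2 ^ j))) as Hs.
    { destruct Hk as [Hk|Hk]; [|exact Hk]. apply (Permutation_in _ (Permutation_sym HP)).
      apply in_or_app; now left. }
    apply in_seq in Hs. lia. }
  assert (Hw : INR (2 ^ j) = 2 ^ j) by (rewrite pow_INR; f_equal; simpl; ring).
  intros r Hr x. replace (300 * disc 8 S (4 * B)) with (3 * (100 * disc 8 S (4 * B))) by ring.
  apply trig_diff_sup_le_grid with (M := (4 * 2 ^ j)%nat); [lia | exact Hrange|].
  intros t Ht. eapply Rle_trans; [|exact Hsmall].
  destruct Hr as [-> | ->].
  - specialize (HD t ltac:(lia)). rewrite lsum_grid_weights_re in HD by exact Ht.
    eapply Rle_trans; [apply Req_le|exact HD]. f_equal. f_equal.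
    unfold trig, T. rewrite lsum_map. apply lsum_ext. intros k _. cbn [fst snd].
    rewrite grid_weights_re, Hw by exact Ht. ring.
  - specialize (HD (4 * (4 * 2 ^ j) + t)%nat ltac:(lia)). rewrite lsum_grid_weights_im in HD.
    eapply Rle_trans; [apply Req_le|exact HD]. f_equal. f_equal.
    unfold trig, T. rewrite lsum_map. apply lsum_ext. intros k _. cbn [fst snd].
    rewrite grid_weights_im, Hw. ring.
Qed.

Lemma block_ordering p q phi B S j T tau : 0 < B -> 0 < S ->
  (forall k, (1 <= k)%nat -> energy p q k <= B / INR k) ->
  lsum (energy p q) (seq (1 + 2 ^ j) (3 * 2 ^ j)) <= S ->
  NoDup T -> (forall k, In k T -> (2 ^ j < k <= 4 * 2 ^ j)%nat) ->
  (forall r, r = p \/ r = q -> forall x, Rabs (trig r phi T x) <= tau) ->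
  exists T', Permutation T T' /\
    forall r, r = p \/ r = q -> forall i x,
      Rabs (trig r phi (firstn i T') x) <= 3 * (tau + 5025 * disc 8 S (4 * B)).
Proof.
  intros HB HS0 Hen HS Hnd HT Htau.
  assert (Hp1 := two_pow_ge_1 j).
  assert (Hpos : 0 < INR (4 * 2 ^ j)) by (apply lt_0_INR; lia).
  assert (Hsp := grid_weights_spread p q phi B S j T HB Hen HS Hnd HT).
  destruct (small_prefix_ordering (grid_weights p q phi (4 * 2 ^ j)) (8 * (4 * 2 ^ j)) 8
    (INR (4 * 2 ^ j)) S (4 * B) ltac:(lra) Hpos HS0 ltac:(lra) (grid_count j) T tau Hsp)
    as [T' [HP HD]].
  { intros t Ht. destruct (le_lt_dec (4 * (4 * 2 ^ j)) t) as [H|H].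
    - replace t with (4 * (4 * 2 ^ j) + (t - 4 * (4 * 2 ^ j)))%nat by lia.
      rewrite lsum_grid_weights_im. apply Htau. now right.
    - rewrite lsum_grid_weights_re by exact H. apply Htau. now left. }
  exists T'. split; [exact HP|].
  assert (HK := disc_pos 8 S (4 * B) ltac:(lra) HS0 ltac:(lra)).
  assert (Hrt : rt8 (INR (length T) / INR (4 * 2 ^ j)) <= 1).
  { apply (pow_le_reg 8); [lia|lra|]. destruct Hsp as [H _].
    rewrite rt8_pow, pow1; [apply Rle_div_l; lra|].
    apply Rmult_le_pos; [apply pos_INR | apply Rlt_le, Rinv_0_lt_compat, Hpos]. }
  assert (Hsmall : tau + 5025 * disc 8 S (4 * B) * rt8 (INR (length T) / INR (4 * 2 ^ j))
    <= tau + 5025 * disc 8 S (4 * B)) by nra.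
  intros r Hr i x.
  replace (trig r phi (firstn i T') x) with (trig r phi (firstn i T') x - trig r phi [] x)
    by (unfold trig; simpl; ring).
  apply trig_diff_sup_le_grid with (M := (4 * 2 ^ j)%nat); [lia | |].
  { intros k Hk. rewrite app_nil_r in Hk.
    assert (Hk' : In k T).
    { apply (Permutation_in _ (Permutation_sym HP)). rewrite <- (firstn_skipn i T').
      apply in_or_app; now left. }
    specialize (HT k Hk'). lia. }
  intros t Ht. eapply Rle_trans; [|exact Hsmall].
  replace (trig r phi [] (grid_pt (4 * (4 * 2 ^ j)) t)) with 0 by reflexivity. rewrite Rminus_0_r.
  destruct Hr as [-> | ->].
  - rewrite <- (lsum_grid_weights_re p q) by exact Ht. apply HD; lia.
  - rewrite <- (lsum_grid_weights_im p q). apply HD; lia.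
Qed.

Lemma coef_bound (d : nat -> C) :
  bigO_seq d (fun k : nat => Rpower (INR k) (- (1 / 2))) ->
  exists B, 0 < B /\ forall k, (1 <= k)%nat -> Cmod (d k) ^ 2 <= B / INR k.
Proof.
  intros [M [K HK]].
  set (s := lsum (fun k => Cmod (d k) ^ 2 * INR k) (seq 0 K)).
  assert (Hpos : forall k, 0 <= Cmod (d k) ^ 2 * INR k)
    by (intros; apply Rmult_le_pos; [apply pow2_ge_0 | apply pos_INR]).
  assert (Hs : 0 <= s) by (apply lsum_nonneg; auto).
  exists (M ^ 2 + s + 1). split; [pose proof (pow2_ge_0 M); lra|].
  intros k Hk. assert (Hk0 : 0 < INR k) by (apply lt_0_INR; lia).
  apply (Rmult_le_reg_r (INR k)); [exact Hk0|].
  unfold Rdiv. rewrite (Rmult_assoc (_ + 1)), Rinv_l, Rmult_1_r by lra.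
  destruct (le_lt_dec K k) as [H|H].
  - specialize (HK k H). rewrite Rpower_Ropp in HK.
    replace (1 / 2) with (/ 2) in HK by field. rewrite Rpower_sqrt in HK by exact Hk0.
    assert (Hq : 0 < / sqrt (INR k)) by (apply Rinv_0_lt_compat, sqrt_lt_R0, Hk0).
    rewrite Rabs_right in HK by lra. pose proof (Cmod_ge_0 (d k)) as H0.
    assert (E : (/ sqrt (INR k)) ^ 2 * INR k = 1).
    { rewrite pow_inv, pow2_sqrt by lra. field. lra. }
    assert (Cmod (d k) ^ 2 <= M ^ 2 * (/ sqrt (INR k)) ^ 2).
    { rewrite <- Rpow_mult_distr. apply pow_incr. lra. }
    assert (Cmod (d k) ^ 2 * INR k <= M ^ 2 * ((/ sqrt (INR k)) ^ 2 * INR k)) by nra.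
    rewrite E in *. lra.
  - assert (Cmod (d k) ^ 2 * INR k <= s).
    { unfold s. assert (Hin : In k (seq 0 K)) by (apply in_seq; lia).
      apply in_split in Hin. destruct Hin as [l1 [l2 ->]]. rewrite lsum_app. cbn [lsum].
      assert (0 <= lsum (fun k => Cmod (d k) ^ 2 * INR k) l1) by (apply lsum_nonneg; auto).
      assert (0 <= lsum (fun k => Cmod (d k) ^ 2 * INR k) l2) by (apply lsum_nonneg; auto).
      lra. }
    pose proof (pow2_ge_0 M). lra.
Qed.

(** * Uniformly convergent rearrangement *)

Lemma dyadic_vallee_poussin_error g p phi :
  (forall x, continuous g x) -> (forall x, g (x + 2 * PI) = g x) -> real_fourier g p phi ->
  exists e : nat -> R, is_lim_seq e 0 /\ forall j x,
    Rabs (p 0%nat + trig p phi (seq 1 (2 ^ j)) x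
      + trig (fun k => INR (2 * 2 ^ j - k) / INR (2 ^ j) * p k) phi (seq (1 + 2 ^ j) (2 ^ j)) x
      - g x) <= e j.
Proof.
  intros Hc Hper HF. apply uniform_error_sequence. intros eps Heps.
  destruct (vallee_poussin_theorem g p phi Hc Hper HF eps Heps) as [C [HC H]].
  exists C. split; [exact HC|]. intros j x.
  replace (2 ^ j) with (INR (2 ^ j)) by (rewrite pow_INR; f_equal; simpl; ring).
  apply H, two_pow_ge_1.
Qed.

Lemma trig_app p phi T1 T2 x : trig p phi (T1 ++ T2) x = trig p phi T1 x + trig p phi T2 x.
Proof. apply lsum_app. Qed.

Lemma trig_perm p phi T1 T2 x : Permutation T1 T2 -> trig p phi T1 x = trig p phi T2 x.
Proof. apply lsum_perm. Qed.

(** With [P j] and [Q j] the frequencies of [(2^j, 2^(j+1)]] rounded to 1 and to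
    0, the sets [{1..2^j} + P j] approximate [g] and grow by
    [Q j + P (j + 1)], which is listed in an order with small prefix sums.
    The Boolean selects the real or the imaginary part. *)
Lemma rearranged_convergence (g : bool -> R -> R) (c : bool -> nat -> R) phi B :
  (forall b x, continuous (g b) x) -> (forall b x, g b (x + 2 * PI) = g b x) ->
  (forall b, real_fourier (g b) (c b) phi) ->
  0 < B -> (forall k, (1 <= k)%nat -> energy (c true) (c false) k <= B / INR k) ->
  exists sigma, permutation_pos sigma /\
    forall eps, 0 < eps -> exists n0, forall n b x, (n0 <= n)%nat ->
      Rabs (c b 0%nat + trig (c b) phi (map sigma (seq 1 n)) x - g b x) <= eps.
Proof.
  intros Hc Hper HF HB Hen.
  destruct (bessel_inequality _ _ _ (Hc true) (HF true)) as [I1 HI1].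
  destruct (bessel_inequality _ _ _ (Hc false) (HF false)) as [I2 HI2].
  destruct (energy_tails (c true) (c false) (I1 + I2)) as [S [HS0 [HSlim HS]]].
  { intros n. unfold energy. rewrite lsum_plus.
    specialize (HI1 n). specialize (HI2 n). lra. }
  assert (Hdlim := disc_lim_0 8 (4 * B) S HSlim).
  set (D := fun j => disc 8 (S j) (4 * B)) in *.
  assert (He : forall b, exists e : nat -> R, is_lim_seq e 0 /\ forall j x,
    Rabs (c b 0%nat + trig (c b) phi (seq 1 (2 ^ j)) x
      + trig (fun k => INR (2 * 2 ^ j - k) / INR (2 ^ j) * c b k) phi (seq (1 + 2 ^ j) (2 ^ j)) x
      - g b x) <= e j)
    by (intros b; now apply dyadic_vallee_poussin_error).
  destruct (He true) as [e1 [He1 Hb1]]. destruct (He false) as [e2 [He2 Hb2]]. clear He.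
  assert (Hround : forall j, exists PQ : list nat * list nat,
    Permutation (seq (1 + 2 ^ j) (2 ^ j)) (fst PQ ++ snd PQ) /\ forall b x,
      Rabs (trig (c b) phi (fst PQ) x - trig (fun k => INR (2 * 2 ^ j - k) / INR (2 ^ j) * c b k)
        phi (seq (1 + 2 ^ j) (2 ^ j)) x) <= 300 * D j).
  { intros j. destruct (block_rounding (c true) (c false) phi B (S j) j HB (HS0 j) Hen (HS j))
      as [P [Q [HPQ Hd]]].
    exists (P, Q). split; [exact HPQ|]. intros b x. apply Hd. destruct b; auto. }
  apply functional_choice in Hround. destruct Hround as [PQ HPQ].
  set (P := fun j => fst (PQ j)). set (Q := fun j => snd (PQ j)).
  assert (HP : forall j, Permutation (seq (1 + 2 ^ j) (2 ^ j)) (P j ++ Q j))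
    by (intros j; apply HPQ).
  assert (HPin : forall j k, In k (P j) -> (2 ^ j < k <= 2 * 2 ^ j)%nat).
  { intros j k Hk. assert (Hs : In k (seq (1 + 2 ^ j) (2 ^ j))).
    { apply (Permutation_in _ (Permutation_sym (HP j))), in_or_app; now left. }
    apply in_seq in Hs. lia. }
  assert (HQin : forall j k, In k (Q j) -> (2 ^ j < k <= 2 * 2 ^ j)%nat).
  { intros j k Hk. assert (Hs : In k (seq (1 + 2 ^ j) (2 ^ j))).
    { apply (Permutation_in _ (Permutation_sym (HP j))), in_or_app; now right. }
    apply in_seq in Hs. lia. }
  assert (HPnd : forall j, NoDup (P j)).
  { intros j. apply (NoDup_app_remove_r (P j) (Q j)).
    apply (Permutation_NoDup (HP j)), seq_NoDup. }
  assert (HQnd : forall j, NoDup (Q j)).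
  { intros j. apply (NoDup_app_remove_l (P j) (Q j)).
    apply (Permutation_NoDup (HP j)), seq_NoDup. }
  set (delta := fun j => Rabs (e1 j) + Rabs (e2 j) + 300 * D j).
  assert (Happrox : forall j b x,
    Rabs (c b 0%nat + trig (c b) phi (seq 1 (2 ^ j) ++ P j) x - g b x) <= delta j).
  { intros j b x. rewrite trig_app. destruct (HPQ j) as [_ Hd]. specialize (Hd b x).
    fold (P j) in Hd.
    set (v := trig (fun k => _ * c b k) phi _ x) in *.
    assert (Hv : Rabs (c b 0%nat + trig (c b) phi (seq 1 (2 ^ j)) x + v - g b x)
      <= Rabs (e1 j) + Rabs (e2 j)).
    { pose proof (Rabs_pos (e1 j)). pose proof (Rabs_pos (e2 j)).
      pose proof (Rle_abs (e1 j)). pose proof (Rle_abs (e2 j)).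
      unfold v. destruct b; [specialize (Hb1 j x) | specialize (Hb2 j x)]; lra. }
    unfold delta. apply Rabs_le_between in Hd, Hv. apply Rabs_le. lra. }
  assert (Horder : forall j, exists L, Permutation (Q j ++ P (Datatypes.S j)) L /\ forall b i x,
    Rabs (trig (c b) phi (firstn i L) x)
      <= 3 * (delta j + delta (Datatypes.S j) + 5025 * D j)).
  { intros j. destruct (block_ordering (c true) (c false) phi B (S j) j (Q j ++ P (Datatypes.S j))
      (delta j + delta (Datatypes.S j)) HB (HS0 j) Hen (HS j)) as [L [HL Hd]].
    - apply NoDup_app; auto. intros k H1 H2. apply HQin in H1. apply HPin in H2.
      simpl in H2. lia.
    - intros k Hk. apply in_app_or in Hk. destruct Hk as [Hk|Hk].
      + apply HQin in Hk. lia.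
      + apply HPin in Hk. simpl in Hk. lia.
    - intros r Hr x.
      assert (G : forall b, Rabs (trig (c b) phi (Q j ++ P (Datatypes.S j)) x)
        <= delta j + delta (Datatypes.S j)).
      { intros b. pose proof (Happrox j b x) as A1.
        pose proof (Happrox (Datatypes.S j) b x) as A2.
        rewrite trig_app in A1, A2. rewrite trig_app.
        replace (2 ^ Datatypes.S j)%nat with (2 ^ j + 2 ^ j)%nat in A2 by (simpl; lia).
        rewrite seq_app, trig_app, (trig_perm _ _ _ _ _ (HP j)), trig_app in A2.
        apply Rabs_le_between in A1, A2. apply Rabs_le. lra. }
      destruct Hr as [-> | ->]; apply G.
    - exists L. split; [exact HL|]. intros b i x. apply Hd. destruct b; auto. }
  apply functional_choice in Horder. destruct Horder as [L HL].
  set (W := fix W j := match j with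
    | 0%nat => seq 1 1 ++ P 0%nat
    | Datatypes.S j => W j ++ L j
    end).
  assert (HW : forall j, Permutation (W j) (seq 1 (2 ^ j) ++ P j)).
  { induction j as [|j IH]; [reflexivity|].
    change (W (Datatypes.S j)) with (W j ++ L j).
    destruct (HL j) as [HLp _]. rewrite IH, <- HLp.
    replace (2 ^ Datatypes.S j)%nat with (2 ^ j + 2 ^ j)%nat by (simpl; lia).
    rewrite seq_app, (HP j), <- !app_assoc. reflexivity. }
  destruct (enumeration_of_chain W L) as [sigma [Hsigma Hmap]].
  { reflexivity. }
  { intros j. exists (P j). split; [apply HW|]. split; [apply HPnd|].
    intros k Hk. now apply HPin. }
  exists sigma. split; [exact Hsigma|].
  set (eta := fun j => delta j + 3 * (delta j + delta (Datatypes.S j) + 5025 * D j)).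
  assert (Hpartial : forall j n b x, (length (W j) <= n <= length (W (Datatypes.S j)))%nat ->
    Rabs (c b 0%nat + trig (c b) phi (map sigma (seq 1 n)) x - g b x) <= eta j).
  { intros j n b x Hn. rewrite (Hmap n (Datatypes.S j)) by lia.
    change (W (Datatypes.S j)) with (W j ++ L j).
    rewrite firstn_app, firstn_all2, trig_app, (trig_perm _ _ _ _ _ (HW j)) by lia.
    pose proof (Happrox j b x) as A1. destruct (HL j) as [_ A2].
    specialize (A2 b (n - length (W j))%nat x). unfold eta.
    apply Rabs_le_between in A1, A2. apply Rabs_le. lra. }
  assert (Heta : is_lim_seq eta 0).
  { assert (Hdelta : is_lim_seq delta 0).
    { replace (Finite 0) with (Finite (0 + 0 + 300 * 0)) by (f_equal; ring).
      unfold delta. apply is_lim_seq_plus'; [apply is_lim_seq_plus'|].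
      - rewrite <- Rabs_R0. now apply (is_lim_seq_abs _ 0).
      - rewrite <- Rabs_R0. now apply (is_lim_seq_abs _ 0).
      - now apply (is_lim_seq_scal_l _ 300 0). }
    assert (Hdelta1 := proj1 (is_lim_seq_incr_1 delta 0) Hdelta).
    replace (Finite 0) with (Finite (0 + 3 * (0 + 0 + 5025 * 0))) by (f_equal; ring).
    unfold eta. apply is_lim_seq_plus'; [exact Hdelta|].
    apply (is_lim_seq_scal_l _ 3 (0 + 0 + 5025 * 0)).
    apply is_lim_seq_plus'; [now apply is_lim_seq_plus'|].
    now apply (is_lim_seq_scal_l _ 5025 0). }
  apply is_lim_seq_spec in Heta. intros eps Heps.
  destruct (Heta (mkposreal eps Heps)) as [J HJ]. simpl in HJ.
  assert (Hlen : forall j, (j <= length (W j))%nat).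
  { intros j. rewrite (Permutation_length (HW j)), length_app, length_seq.
    pose proof (Nat.pow_gt_lin_r 2 j ltac:(lia)). lia. }
  exists (length (W J)). intros n b x Hn.
  assert (Hfind : forall m, (n <= length (W (J + m)))%nat -> exists j, (J <= j)%nat /\
    (length (W j) <= n <= length (W (Datatypes.S j)))%nat).
  { induction m as [|m IH]; intros Hm.
    - rewrite Nat.add_0_r in Hm. exists J. split; [lia|]. split; [lia|].
      change (W (Datatypes.S J)) with (W J ++ L J). rewrite length_app. lia.
    - destruct (le_lt_dec n (length (W (J + m)%nat))) as [H|H]; [now apply IH|].
      exists (J + m)%nat. split; [lia|]. split; [lia|].
      now replace (Datatypes.S (J + m)) with (J + Datatypes.S m)%nat by lia. }
  destruct (Hfind n) as [j [Hj Hjn]].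
  { pose proof (Hlen (J + n)%nat). lia. }
  specialize (HJ j Hj). rewrite Rminus_0_r in HJ.
  eapply Rle_trans; [now apply (Hpartial j)|].
  pose proof (Rle_abs (eta j)). lra.
Qed.

Theorem theorem4 (f : R -> C) (A : nat -> R -> C) (d : nat -> C) (phi : nat -> R)
  (hf : continuous_on_T f)
  (hA : has_fourier_series f A)
  (hA0 : forall x : R, A 0%nat x = d 0%nat)
  (hAk : forall (k : nat) (x : R), (1 <= k)%nat ->
     A k x = Cmult (d k) (RtoC (cos (INR k * x + phi k))))
  (hd : bigO_seq d (fun k : nat => Rpower (INR k) (- (1 / 2)))) :
  exists sigma : nat -> nat,
    permutation_pos sigma /\
    is_lim_seq
      (fun n : nat =>
         unif_norm (fun x : R =>
           Cminus (Cminus (f x) (d 0%nat))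
             (sum_n_m (fun k : nat => A (sigma k) x) 1 n)))
      0.
Proof.
  destruct hf as [Hf Hper].
  destruct (real_fourier_parts f A d phi Hf hA hA0 hAk) as [Fre Fim].
  destruct (coef_bound d hd) as [B [HB Hd]].
  destruct (rearranged_convergence
    (fun b x => if b then fst (f x) else snd (f x))
    (fun b k => if b then fst (d k) else snd (d k)) phi B) as [sigma [Hsigma Hconv]].
  - intros [|] x.
    + apply (continuous_comp f fst); [apply Hf | apply continuous_fst].
    + apply (continuous_comp f snd); [apply Hf | apply continuous_snd].
  - intros [|] x; now rewrite Hper.
  - intros [|]; assumption.
  - exact HB.
  - intros k Hk. unfold energy. rewrite <- Cmod_sqr. now apply Hd.
  - exists sigma. split; [exact Hsigma|].
    apply is_lim_seq_spec. intros [eps Heps]. simpl.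
    destruct (Hconv (eps / 4) ltac:(lra)) as [n0 Hn0]. exists n0. intros n Hn.
    assert (Hbound : forall x, Cmod (Cminus (Cminus (f x) (d 0%nat))
      (sum_n_m (fun k : nat => A (sigma k) x) 1 n)) <= eps / 2).
    { intros x. eapply Rle_trans; [apply Cmod_le_parts|].
      assert (Hsum : sum_n_m (fun k : nat => A (sigma k) x) 1 n =
        (trig (fun k => fst (d k)) phi (map sigma (seq 1 n)) x,
         trig (fun k => snd (d k)) phi (map sigma (seq 1 n)) x)).
      { rewrite sum_n_m_parts. unfold trig. rewrite !lsum_map.
        f_equal; apply lsum_ext; intros k Hk; apply in_seq in Hk;
          rewrite hAk by (apply Hsigma; lia); unfold Cmult, RtoC; simpl; ring. }
      rewrite Hsum.
      pose proof (Hn0 n true x Hn) as H1. pose proof (Hn0 n false x Hn) as H2.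
      cbv beta iota in H1, H2.
      unfold Cminus, Cplus, Copp. cbn [fst snd].
      rewrite <- Rabs_Ropp in H1, H2.
      apply Rle_trans with (eps / 4 + eps / 4); [|lra].
      apply Rplus_le_compat.
      - eapply Rle_trans; [|exact H1]. apply Req_le. f_equal. ring.
      - eapply Rle_trans; [|exact H2]. apply Req_le. f_equal. ring. }
    destruct (unif_norm_bounds _ _ Hbound) as [[U1 U2] _].
    rewrite Rminus_0_r, Rabs_right; lra.
Qed.
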